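(* Let $d\ge 1$, let $\mathcal{W}\subseteq\mathbb{R}^d$ be bounded, and for every $k\in\mathbb{N}$ let $\Lambda_k=\frac{1}{n_k}A_k\mathbb{Z}^d+v_k$ be a lattice (with the assumptions on $n_k,A_k,v_k$ and the limit matrix $A$ given in the context), and let $g_k:\mathcal{W}\cap\Lambda_k\to\mathbb{C}$ and $h_k:\mathcal{W}\to\mathbb{R}$ be functions such that these objects satisfy the discrete Laplace assumptions, with point $x_0$ and limit functions $g,h$. Then $$\lim_{k\to\infty}n_k^{-\frac d2}e^{n_kh(x_0)}\sum_{x\in\mathcal{W}\cap\Lambda_k}g_k(x)e^{-n_kh_k(x)}=\frac{(2\pi)^{\frac d2}\,g(x_0)}{|\det(A)|\sqrt{\det(\mathcal{H}\{h\}(x_0))}}.$$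
   Context: Lattices: $\Lambda_k=\frac1{n_k}A_k\mathbb{Z}^d+v_k$, where $(n_k)_k$ is a sequence of positive integers with $n_k\ge k$, $(v_k)_k\subseteq\mathbb{R}^d$ converges to some $v\in\mathbb{R}^d$, and $(A_k)_k\subseteq\mathbb{R}^{d\times d}$ converges to an invertible matrix $A\in\mathbb{R}^{d\times d}$. $\mathcal{H}\{h\}(x)$ denotes the Hessian matrix of $h$ at $x$, and $\|f\|_{\infty,S}=\sup_{x\in S}|f(x)|$. Discrete Laplace assumptions for $\mathcal{W}$, $\Lambda_k$, $g_k:\mathcal{W}\cap\Lambda_k\to\mathbb{C}$, $h_k:\mathcal{W}\to\mathbb{R}$: there exists $x_0\in\mathrm{Int}(\mathcal{W})$ and an open neighborhood $\mathcal{N}_0\subseteq\mathcal{W}$ of $x_0$ such that $h_k\in C^2(\mathcal{N}_0)$ for every $k$, and (i) there exist functions $g\in C(\mathcal{N}_0)$ and $h\in C^2(\mathcal{N}_0)$ with $\lim_{k\to\infty}\|g_k-g\|_{\infty,\mathcal{N}_0\cap\Lambda_k}=0$ and $\lim_{k\to\infty}\|h_k-h\|_{C^2(\mathcal{N}_0)}=0$; (ii) $h_k(x_0)=h(x_0)$ and $\nabla h_k(x_0)=0$ for every $k$, and $\mathcal{H}\{h\}(x_0)$ is strictly positive definite; (iii) for every open neighborhood $\mathcal{N}$ of $x_0$, $\liminf_{k\to\infty}\inf_{x\in\mathcal{W}\setminus\mathcal{N}}h_k(x)>h(x_0)$; (iv) there exist $C_g\ge0$ and $\ell\in\mathbb{N}$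 such that $\|g_k\|_{\infty,\mathcal{W}\cap\Lambda_k}\le C_gk^{\ell}$ for every $k\in\mathbb{N}$. *)

(* Defs.v *)
From HB Require Import structures.
From mathcomp Require Import all_boot all_order all_algebra.
From mathcomp Require Import complex.
From mathcomp Require Import all_classical all_reals all_analysis.

Set Implicit Arguments.
Unset Strict Implicit.
Unset Printing Implicit Defensive.

Import Order.TTheory GRing.Theory Num.Theory.
Import numFieldNormedType.Exports.

Local Open Scope classical_set_scope.
Local Open Scope ring_scope.
Local Open Scope complex_scope.

(* Functions given only on a subset of R^d are represented by total functions,
   and every condition below only involves their values on that subset
   (derivatives are only taken on open subsets).
   Sequences are indexed by the positive integers: the value at 0 of a sequence
   on [nat] is never constrained. *)

(* (1/n) A Z^d + v; points of R^d are row vectors, so [z *m A^T] is the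
   transpose of the column vector A z. *)
Definition lattice (R : realType) (d n : nat) (A : 'M[R]_d) (v : 'rV[R]_d) :
    set 'rV[R]_d :=
  [set x | exists z : 'rV[int]_d, x = n%:R^-1 *: (map_mx intr z *m A^T) + v].

(* The supremum is taken in [0, +oo]: it is 0 on the empty set, whereas
   [ereal_sup set0 = -oo]. *)
Definition supnorm (R : realType) (T : Type) (S : set T) (f : T -> R) : \bar R :=
  maxe 0%E (ereal_sup [set `|f x|%:E | x in S]).

(* On [R[i]] the library norm takes its values in [R[i]]; [Normc.normc] is the
   modulus as an element of [R]. *)
Definition csupnorm (R : realType) (T : Type) (S : set T) (f : T -> R[i]) :
    \bar R :=
  supnorm S (fun x => Normc.normc (f x)).

Definition partial (R : realType) (d : nat) (i : 'I_d) (f : 'rV[R]_d -> R) :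
    'rV[R]_d -> R :=
  fun x => 'D_(delta_mx 0 i) f x.

Definition gradient (R : realType) (d : nat) (f : 'rV[R]_d -> R)
    (x : 'rV[R]_d) : 'rV[R]_d :=
  \row_i partial i f x.

Definition hessian (R : realType) (d : nat) (f : 'rV[R]_d -> R)
    (x : 'rV[R]_d) : 'M[R]_d :=
  \matrix_(i, j) partial j (partial i f) x.

(* Meant for open [N]. *)
Definition C2_on (R : realType) (d : nat) (N : set 'rV[R]_d)
    (f : 'rV[R]_d -> R) : Prop :=
  [/\ {within N, continuous f},
      forall i, {in N, forall x, derivable f x (delta_mx 0 i)},
      forall i, {within N, continuous (partial i f)},
      forall i j, {in N, forall x, derivable (partial i f) x (delta_mx 0 j)} &
      forall i j, {within N, continuous (partial j (partial i f))}].

(* The maximum of the sup norms of the derivatives of order at most 2; it may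
   be +oo. *)
Definition C2_norm (R : realType) (d : nat) (N : set 'rV[R]_d)
    (f : 'rV[R]_d -> R) : \bar R :=
  maxe (supnorm N f)
    (maxe (\big[maxe/0%E]_(i < d) supnorm N (partial i f))
          (\big[maxe/0%E]_(i < d) \big[maxe/0%E]_(j < d)
             supnorm N (partial j (partial i f)))).

(* Only used for Hessians of C^2 functions, so symmetry is not required. *)
Definition posdefmx (R : realType) (d : nat) (M : 'M[R]_d) : Prop :=
  forall v : 'rV[R]_d, v != 0 -> 0 < (v *m M *m v^T) 0 0.

Record discrete_laplace (R : realType) (d : nat) (W : set 'rV[R]_d)
    (Lambda : nat -> set 'rV[R]_d)
    (g_ : nat -> 'rV[R]_d -> R[i]) (h_ : nat -> 'rV[R]_d -> R)
    (x0 : 'rV[R]_d) (N0 : set 'rV[R]_d)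
    (g : 'rV[R]_d -> R[i]) (h : 'rV[R]_d -> R) : Prop := DiscreteLaplace {
  dl_interior : W° x0 ;
  dl_open : open N0 ;
  dl_nbhd : N0 x0 ;
  dl_sub : N0 `<=` W ;
  dl_h_C2 : forall k, (0 < k)%N -> C2_on N0 (h_ k) ;
  dl_g_cont : {within N0, continuous (g : 'rV[R]_d -> R[i]^o)} ;
  dl_hlim_C2 : C2_on N0 h ;
  dl_g_cvg : csupnorm (N0 `&` Lambda k) (g_ k \- g) @[k --> \oo] --> 0%E ;
  dl_h_cvg : C2_norm N0 (h_ k \- h) @[k --> \oo] --> 0%E ;
  dl_h_x0 : forall k, (0 < k)%N -> h_ k x0 = h x0 ;
  dl_grad_x0 : forall k, (0 < k)%N -> gradient (h_ k) x0 = 0 ;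
  dl_hess_x0 : posdefmx (hessian h x0) ;
  dl_sep : forall N : set 'rV[R]_d, open N -> N x0 ->
    ((h x0)%:E <
       limn_einf (fun k => ereal_inf [set (h_ k x)%:E | x in W `\` N]))%E ;
  dl_growth : exists Cg : R, exists l : nat, 0 <= Cg /\
    forall k, (0 < k)%N ->
      (csupnorm (W `&` Lambda k) (g_ k) <= (Cg * k%:R ^+ l)%:E)%E
}.

(* Main.v *)
Require Import Defs.
From HB Require Import structures.
From mathcomp Require Import all_boot all_order all_algebra.
From mathcomp Require Import complex.
From mathcomp Require Import all_classical all_reals all_analysis.
From mathcomp Require Import measurable_realfun.
From mathcomp Require Import ring lra zify.
Import Order.TTheory GRing.Theory Num.Theory.
Import numFieldNormedType.Exports.

(** Write L for the right-hand side without the factor g(x0), and weigh the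
    lattice point x by n^(-d/2) exp(-n (h_k(x) - h(x0))), where n = n_k. The
    theorem says that these weights converge, as measures, to the point mass
    L at x0, even against functions g_k which away from x0 are only bounded
    by a power of k.

    Away from x0 the exponent is at least c n, which beats every power of n
    ([tail_mass]). Close to x0 the exponent is n/2 times a quadratic form in
    x - x0, up to a factor close to 1 ([local_quadratic]), because h_k has a
    critical point at x0 and its second derivatives are uniformly close to
    those of h. In the coordinates u = A_k^-1 (x - x0) the lattice becomes a
    shift of n^-1 Z^d, and the form becomes B = A^T H A, with H the Hessian
    of h at x0, again up to a factor close to 1 ([qform_lattice_coord]). So
    only sums of Gaussians with a fixed form over shifts of s Z^d remain,
    with s = n^(-1/2), and they must be compared with (2 pi)^(d/2) /
    sqrt(det B) = L, uniformly in the shift ([local_mass]).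

    That comparison ([lattice_gauss_sum_cvg]) needs no integration in
    several variables. In dimension one a Riemann sum of mesh s of a
    function which is monotone on both sides of its maximum 1 is within 2s
    of the integral, wherever the mesh is placed ([gauss_sum_progression]).
    In dimension d one completes the square in the first coordinate: for
    fixed other coordinates the sum over the first one is a one-dimensional
    Gaussian sum, whose shift depends on the other coordinates but whose
    value, up to O(s), does not. It factors out, and the Schur complement of
    the corner of B, whose determinant is det B divided by that corner, is
    left for the induction.

    Infinite sums of nonnegative terms are taken in the extended reals,
    where rearranging and splitting them is free. The number of lattice
    points in the bounded set W is never counted: a constant on W is
    dominated by a flat Gaussian, to which the same estimate applies. *)

Set Implicit Arguments.
Unset Strict Implicit.
Unset Printing Implicit Defensive.

Local Open Scope classical_set_scope.
Local Open Scope ring_scope.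
Local Open Scope complex_scope.

(** * Gaussian sums over an arithmetic progression *)

Lemma itv0y_bigcup (R : realType) (s : R) : 0 < s ->
  `[0, +oo[%classic = \bigcup_m `[s * m%:R, s * m.+1%:R[%classic.
Proof.
move=> s0; apply/seteqP; split => [x|x [m _]] /=; rewrite !in_itv/= ?andbT.
  move=> x0; exists (Num.truncn (x / s)) => //=.
  have /andP[h1 h2] := truncn_itv (divr_ge0 x0 (ltW s0)).
  by rewrite in_itv/= mulrC -ler_pdivlMr// h1 mulrC -ltr_pdivrMr.
by move=> /andP[+ _]; apply: le_trans; rewrite mulr_ge0// ltW.
Qed.

Lemma trivIset_steps (R : realType) (s : R) : 0 < s ->
  trivIset setT (fun m => `[s * m%:R, s * m.+1%:R[%classic).
Proof.
move=> s0; apply/trivIsetP => i j _ _ ij; rewrite -subset0 => x.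
wlog ij' : i j ij / (i < j)%N.
  move=> H [xi xj]; have [ij'|ij'|ij'] := ltngtP i j.
  - exact: (H i j).
  - by apply: (H j i) => //; rewrite eq_sym.
  - by rewrite ij' eqxx in ij.
rewrite /= !in_itv/= => -[/andP[_ xi] /andP[xj _]].
have := le_lt_trans xj xi; rewrite ltr_pM2l// ltr_nat ltnS => ?.
by move: ij'; rewrite ltnNge => /negP.
Qed.

Lemma esum_nat_recl (R : realType) (a : nat -> \bar R) : (forall m, 0 <= a m)%E
  ->
  (\esum_(m in [set: nat]) a m = a 0%N + \esum_(m in [set: nat]) a m.+1)%E.
Proof.
move=> a0; rewrite (esumID [set 0%N])// !setTI esum_set1//; congr (_ + _)%E.
apply: (reindex_esum [set: nat] _ succn); split => //.
- by move=> x y _ _ [].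
- by case=> [/(_ erefl)//|m _]; exists m.
Qed.

(** On the half-line a step is compared with the integral over the neighbouring
    step: a nonincreasing function lies below its values on the left and above
    those on the right, so only the first step is lost. *)
Lemma half_line_sum (R : realType) (f : R -> R) (I s t : R) :
  0 < s -> 0 <= t <= s -> measurable_fun [set: R] f ->
  (forall x, 0 <= f x <= 1) ->
  (forall x y, 0 <= x -> x <= y -> f y <= f x) ->
  (\int[lebesgue_measure]_(x in `[0%R, +oo[) (f x)%:E)%E = I%:E ->
  ((\esum_(m in [set: nat]) (s * f (s * m%:R + t))%:E <= (I + s)%:E) /\
  (I%:E <= \esum_(m in [set: nat]) (s * f (s * m%:R + t))%:E + s%:E))%E.
Proof.
move=> s0 /andP[t0 ts] mf f01 fdec intf.
have f0 x : 0 <= f x by case/andP: (f01 x).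
have f1 x : f x <= 1 by case/andP: (f01 x).
pose D m := `[s * m%:R, s * m.+1%:R[%classic.
pose J m := (\int[lebesgue_measure]_(x in D m) (f x)%:E)%E.
have mE (E : set R) : measurable_fun E (EFin \o f).
  by apply/measurable_EFinP; exact: measurable_funTS.
have mD m : measurable (D m) by exact: measurable_itv.
have J0 m : (0 <= J m)%E by apply: integral_ge0 => x _; rewrite lee_fin.
have step m (c : R) : (\int[@lebesgue_measure R]_(x in D m) (cst c%:E) x = (s *
  c)%:E)%E.
  rewrite integral_cst//= /D; last exact: measurable_itv.
  rewrite lebesgue_measure_itv/= lte_fin ltr_pM2l// ltr_nat ltnSn.
  by rewrite -EFinB -EFinM -mulrBr -natrB// subSnn mulr1 mulrC.
have sumJ : (\sum_(i <oo) J i = I%:E)%E.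
  rewrite -intf (itv0y_bigcup s0) ge0_integral_bigcup//.
  - exact: mE.
  - by move=> x _; rewrite lee_fin.
  - exact: trivIset_steps.
have Jub m : (J m <= (s * f (s * m%:R))%:E)%E.
  rewrite -(step m); apply: ge0_le_integral => //=.
  - exact: mD.
  - by move=> x _; rewrite lee_fin.
  - exact: mE.
  - by move=> x; rewrite /D/= in_itv/= => /andP[h _];
      rewrite lee_fin fdec// mulr_ge0// ltW.
have Jlb m : ((s * f (s * m.+1%:R))%:E <= J m)%E.
  rewrite -(step m); apply: ge0_le_integral => //=.
  - exact: mD.
  - by move=> x _; rewrite lee_fin.
  - exact: mE.
  - move=> x; rewrite /D/= in_itv/= => /andP[h1 h2];
      rewrite lee_fin fdec// ?(ltW h2)//.
    by rewrite (le_trans _ h1)// mulr_ge0// ltW.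
have a0 m : (0 <= (s * f (s * m%:R + t))%:E)%E by rewrite lee_fin mulr_ge0//
  ltW.
rewrite nneseries_esumT// in sumJ; split.
  rewrite esum_nat_recl// addeC EFinD leeD//; last first.
    by rewrite lee_fin ler_piMr// ltW.
  rewrite -sumJ; apply: le_esum => m _.
  apply: le_trans (Jlb m); rewrite lee_fin ler_pM2l// fdec// ?mulr_ge0 ?(ltW
    s0)//.
  by rewrite lerDl.
rewrite -sumJ (esum_nat_recl J0) [X in (X <= _)%E]addeC; apply: leeD.
  apply: le_esum => m _.
  apply: le_trans (Jub _) _; rewrite lee_fin ler_pM2l// fdec//.
    by rewrite addr_ge0// mulr_ge0// ltW.
  by rewrite -addn1 natrD mulrDr mulr1 lerD2l.
by apply: le_trans (Jub 0%N) _; rewrite lee_fin ler_piMr// ltW.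
Qed.

Lemma ge0_esumZl (R : realType) (T : choiceType) (c : R) (a : T -> \bar R)
    (P : set T) : 0 < c -> (forall x, 0 <= a x)%E ->
  (\esum_(x in P) (c%:E * a x) = c%:E * \esum_(x in P) a x)%E.
Proof.
have le_esumZ (k : R) (b : T -> \bar R) : 0 < k -> (forall x, 0 <= b x)%E ->
    (\esum_(x in P) (k%:E * b x) <= k%:E * \esum_(x in P) b x)%E.
  move=> k0 b0; apply: ge_ereal_sup => _ [X [finX XP] <-].
  rewrite -ge0_mule_fsumr// lee_pmul2l// ?lte_fin//.
  by apply: ereal_sup_ubound; exists X.
move=> c0 a0; apply/eqP; rewrite eq_le le_esumZ//=.
rewrite -lee_pdivlMl//.
have := le_esumZ c^-1 (fun x => c%:E * a x)%E.
rewrite invr_gt0 => /(_ c0 (fun x => mule_ge0 (ltW c0 : 0 <= c%:E)%E (a0 x))).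
apply: le_trans; rewrite le_eqVlt; apply/orP; left; apply/eqP/eq_esum => x _.
by rewrite muleA -EFinM mulVf ?mul1e// gt_eqF.
Qed.

Lemma esum_int (R : realType) (a : int -> \bar R) : (forall m, 0 <= a m)%E ->
  (\esum_(m in [set: int]) a m = \esum_(m in [set: nat]) a (Posz m) +
    \esum_(m in [set: nat]) a (Negz m))%E.
Proof.
move=> a0; rewrite (esumID [set m | 0 <= m])// !setTI; congr (_ + _)%E.
  apply: (reindex_esum [set: nat] _ Posz); split => //.
  - by move=> x y _ _ [].
  - by case=> // m _; exists m.
apply: (reindex_esum [set: nat] _ Negz); split => //.
- by move=> x y _ _ [].
- by case=> m //= _; exists m.
Qed.

(** Cut at 0, the progression gives two half-line sums with offsets r and s - r,
    the negative half being reflected by evenness of the Gaussian; each of them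
    is off by at most s. *)
Lemma gauss_sum_line (R : realType) (s t : R) : 0 < s ->
  ((\esum_(m in [set: int]) (s * gauss_fun (s * m%:~R + t))%:E <=
     (Num.sqrt pi + 2 * s)%:E) /\
  ((Num.sqrt pi)%:E <=
    \esum_(m in [set: int]) (s * gauss_fun (s * m%:~R + t))%:E + (2 * s)%:E))%E.
Proof.
move=> s0.
have a0 x : (0 <= (s * gauss_fun x)%:E)%E.
  by rewrite lee_fin mulr_ge0// ?gauss_fun_ge0// ltW.
(* A shift of the summation index brings the offset into [0, s[. *)
pose r := t - s * (Num.floor (t / s))%:~R.
have r0s : 0 <= r <= s.
  have := floor_itv (t / s); rewrite intrD => /andP[h1 h2]; apply/andP; split.
    by rewrite subr_ge0 mulrC -ler_pdivlMr.
  rewrite lerBlDr -[X in X + _](mulr1 s) -mulrDr mulrC -ler_pdivrMr// addrC.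
  exact: ltW.
have -> : (\esum_(m in [set: int]) (s * gauss_fun (s * m%:~R + t))%:E =
    \esum_(m in [set: int]) (s * gauss_fun (s * m%:~R + r))%:E)%E.
  rewrite (reindex_esum setT _ (fun m => m - Num.floor (t / s)))//; last first.
    split => //; first by move=> x y _ _ /addIr.
    by move=> y _; exists (y + Num.floor (t / s)) => //; rewrite addrK.
  apply: eq_esum => m _; congr (_ * gauss_fun _)%:E.
  by rewrite /r rmorphB/= mulrBr; ring.
have sr0s : 0 <= s - r <= s.
  by case/andP: r0s => ? ?; rewrite subr_ge0 gerBl; apply/andP.
have gdec (x y : R) : 0 <= x -> x <= y -> gauss_fun y <= gauss_fun x.
  move=> x0 xy; rewrite ler_expR lerN2 lerXn2r// nnegrE//.
  exact: le_trans xy.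
have g01 (x : R) : 0 <= gauss_fun x <= 1 by rewrite gauss_fun_ge0 gauss_fun_le1.
have [hp1 hp2] := half_line_sum s0 r0s measurable_gauss_fun g01 gdec
  integral0y_gauss.
have [hn1 hn2] := half_line_sum s0 sr0s measurable_gauss_fun g01 gdec
  integral0y_gauss.
rewrite esum_int//.
have -> : (\esum_(m in [set: nat]) (s * gauss_fun (s * (Negz m)%:~R + r))%:E =
    \esum_(m in [set: nat]) (s * gauss_fun (s * m%:R + (s - r)))%:E)%E.
  apply: eq_esum => m _; congr (_ * _)%:E; rewrite /gauss_fun;
    congr (expR (- _)).
  by rewrite NegzE rmorphN /= -pmulrn -addn1 natrD; ring.
split.
  have -> : Num.sqrt pi + 2 * s = (Num.sqrt pi / 2 + s) + (Num.sqrt pi / 2 + s)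
    :> R.
    by field.
  by rewrite EFinD leeD.
have -> : Num.sqrt pi = Num.sqrt pi / 2 + Num.sqrt pi / 2 :> R by field.
rewrite EFinD (_ : 2 * s = s + s); last by ring.
by rewrite EFinD addeACA leeD.
Qed.

(** Rescaling by sqrt (b / 2). The bound is uniform in the offset t, which is
    what allows the induction on the dimension. *)
Lemma gauss_sum_progression (R : realType) (b s t : R) : 0 < b -> 0 < s ->
  let S := (\esum_(m in [set: int])
    (s * expR (- (b / 2 * (s * m%:~R + t) ^+ 2)))%:E)%E in
  ((S <= (Num.sqrt (2 * pi / b) + 2 * s)%:E) /\
  ((Num.sqrt (2 * pi / b))%:E <= S + (2 * s)%:E))%E.
Proof.
move=> b0 s0.
pose c := Num.sqrt (b / 2).
have c0 : 0 < c by rewrite sqrtr_gt0 divr_gt0.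
have cn0 : c != 0 by rewrite gt_eqF.
have c2 : c ^+ 2 = b / 2 by rewrite sqr_sqrtr// divr_ge0// ltW.
have [h1 h2] := gauss_sum_line (c * t) (mulr_gt0 c0 s0).
have sqE : Num.sqrt (2 * pi / b) = c^-1 * Num.sqrt pi.
  rewrite /c -sqrtrV ?divr_ge0 ?(ltW b0)// -sqrtrM ?invr_ge0 ?divr_ge0 ?(ltW
    b0)//.
  congr Num.sqrt; field; exact: lt0r_neq0.
set S' := esum _ _ in h1 h2.
move=> S; have -> : S = (c^-1%:E * S')%E.
  rewrite /S /S' -ge0_esumZl.
  - apply: eq_esum => m _; rewrite -EFinM /gauss_fun -c2; congr EFin.
    rewrite !mulrA mulVf// mul1r; congr (_ * expR (- _)); ring.
  - by rewrite invr_gt0.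
  - by move=> m; rewrite lee_fin mulr_ge0 ?gauss_fun_ge0// ltW// mulr_gt0.
rewrite sqE; split.
  have -> : c^-1 * Num.sqrt pi + 2 * s = c^-1 * (Num.sqrt pi + 2 * (c * s)).
    by field.
  by rewrite EFinM lee_pmul2l// lte_fin invr_gt0.
have -> : ((2 * s)%:E = c^-1%:E * (2 * (c * s))%:E)%E.
  by rewrite -EFinM; congr EFin; field.
rewrite -ge0_muleDr// ?lee_fin ?mulr_ge0 ?(ltW c0) ?(ltW s0)//.
  by rewrite EFinM lee_pmul2l// lte_fin invr_gt0.
apply: esum_ge0 => m _; rewrite lee_fin mulr_ge0 ?gauss_fun_ge0// mulr_ge0//
  ltW//.
Qed.

(** * Quadratic forms and completing the square *)

Definition qform (R : realType) (d : nat) (B : 'M[R]_d) (u : 'rV[R]_d) : R :=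
  (u *m B *m u^T) 0 0.

Lemma qformE (R : realType) d (B : 'M[R]_d) u :
  qform B u = \sum_j (\sum_i u 0 i * B i j) * u 0 j.
Proof.
rewrite /qform mxE; apply: eq_bigr => j _; rewrite !mxE; congr (_ * _).
Qed.

Lemma qform_scale (R : realType) d (B : 'M[R]_d) a u :
  qform B (a *: u) = a ^+ 2 * qform B u.
Proof.
by rewrite /qform linearZ /= -scalemxAr -!scalemxAl !mxE mulrA expr2.
Qed.

Lemma qform_scalemx (R : realType) d (B : 'M[R]_d) a u :
  qform (a *: B) u = a * qform B u.
Proof. by rewrite /qform -scalemxAr -scalemxAl mxE. Qed.

Section schur.
Variables (R : realType) (d : nat) (B : 'M[R]_(1 + d)).
Hypotheses (Bsym : B^T = B) (Bpos : posdefmx B).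

Let b := B 0 0.
Let c : 'rV[R]_d := ursubmx B.

(** The Schur complement of the corner entry. *)
Definition schur : 'M[R]_d := drsubmx B - b^-1 *: (c^T *m c).

Let blockB : B = block_mx b%:M c c^T (drsubmx B).
Proof.
have ulB : ulsubmx B = b%:M.
  rewrite [LHS]mx11_scalar; congr (_%:M); rewrite !mxE; congr (B _ _);
    exact/val_inj.
by rewrite -[LHS]submxK ulB /c trmx_ursub Bsym.
Qed.

Lemma qform_row_mx (x : R) (y : 'rV[R]_d) :
  qform B (row_mx x%:M y) = b * x ^+ 2 + 2 * x * (y *m c^T) 0 0 + qform
    (drsubmx B) y.
Proof.
rewrite /qform [in LHS]blockB mul_row_block tr_row_mx mul_row_col !mulmxDl.
have -> : x%:M *m c *m y^T = (x * (y *m c^T) 0 0)%:M.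
  rewrite mul_scalar_mx -scalemxAl [c *m y^T]mx11_scalar scale_scalar_mx;
    congr (_ * _)%:M.
  by rewrite -[in RHS](trmxK y) -trmx_mul [RHS]mxE.
rewrite mul_scalar_mx tr_scalar_mx scale_scalar_mx [y *m c^T in LHS]mx11_scalar
  -!scalar_mxM !mxE/=.
by rewrite !mulr1n; ring.
Qed.

Lemma posdef_corner : 0 < b.
Proof.
have : row_mx 1%:M 0 != 0 :> 'rV[R]_(1 + d).
  apply/eqP => /rowP /(_ 0); rewrite !mxE.
  case: splitP => // j _; rewrite !mxE (ord1 j) eqxx => /eqP;
    by rewrite oner_eq0.
move/Bpos; rewrite -/(qform _ _) qform_row_mx /qform !mul0mx !mxE.
by rewrite expr1n !mulr1 mulr0 !addr0.
Qed.

Let bn0 : b != 0. Proof. by rewrite gt_eqF// posdef_corner. Qed.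

Lemma complete_square (x : R) (y : 'rV[R]_d) :
  qform B (row_mx x%:M y) =
  b * (x + b^-1 * (y *m c^T) 0 0) ^+ 2 + qform schur y.
Proof.
rewrite qform_row_mx /schur /qform mulmxBr mulmxBl.
rewrite -scalemxAr -scalemxAl !mulmxA.
have -> : y *m c^T *m c *m y^T = ((y *m c^T) 0 0 ^+ 2)%:M.
  rewrite -mulmxA [y *m c^T]mx11_scalar mul_scalar_mx [c *m y^T]mx11_scalar.
  rewrite scale_scalar_mx; congr (_%:M).
  by rewrite -[in c *m _](trmxK c) -trmx_mul !mxE/= mulr1n expr2.
rewrite !mxE/= mulr1n; field; exact: bn0.
Qed.

Lemma schur_sym : schur^T = schur.
Proof.
by rewrite /schur linearB linearZ /= trmx_drsub Bsym trmx_mul trmxK.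
Qed.

Lemma schur_posdef : posdefmx schur.
Proof.
move=> y y0; rewrite -/(qform _ _).
pose x := - (b^-1 * (y *m c^T) 0 0).
have : row_mx x%:M y != 0 :> 'rV[R]_(1 + d).
  by apply: contra_neq y0 => /(congr1 rsubmx); rewrite row_mxKr linear0.
by move/Bpos; rewrite -/(qform _ _) complete_square /x addNr expr0n/= mulr0
  add0r.
Qed.

Lemma det_schur : \det B = b * \det schur.
Proof.
(* A column operation clears the first row. *)
have := congr1 determinant (mulmx_block b%:M c c^T (drsubmx B)
  1%:M (- (b^-1 *: c)) 0 1%:M).
rewrite -blockB det_mulmx det_ublock !det1 !mulr1 => ->.
rewrite !mulmx1 !mulmx0 !addr0 mulmxN mul_scalar_mx scalerA divff// scale1r
  addNr.
by rewrite det_lblock det_scalar1 mulmxN -scalemxAr addrC.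
Qed.

End schur.

Lemma posdef_det_gt0 (R : realType) d (B : 'M[R]_d) :
  B^T = B -> posdefmx B -> 0 < \det B.
Proof.
elim: d B => [|d IH] B Bs Bp; first by rewrite det_mx00.
rewrite (@det_schur R d B)// mulr_gt0 ?(@posdef_corner R d B)//.
by apply: IH; [exact: schur_sym|exact: schur_posdef].
Qed.

(** * Gaussian sums over shifted lattices *)

Definition lattice_gauss_sum (R : realType) (d : nat) (B : 'M[R]_d) (s : R)
    (t : 'rV[R]_d) : \bar R :=
  (\esum_(z in [set: 'rV[int]_d])
     (s ^+ d * expR (- (qform B (s *: map_mx intr z + t) / 2)))%:E)%E.

Lemma lattice_gauss_sum_ge0 (R : realType) (d : nat) (B : 'M[R]_d) (s : R)
    (t : 'rV[R]_d) : 0 <= s -> (0 <= lattice_gauss_sum B s t)%E.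
Proof.
by move=> s0; apply: esum_ge0 => z _; rewrite lee_fin mulr_ge0 ?expR_ge0
  ?exprn_ge0.
Qed.

(** For fixed other coordinates z, the first coordinate runs through a
    progression of step s; its offset tau z absorbs the cross term of the
    completed square. *)
Lemma lattice_gauss_sumS (R : realType) (d : nat) (B : 'M[R]_(1 + d)) (s : R)
    (t : 'rV[R]_(1 + d)) : B^T = B -> posdefmx B -> 0 <= s ->
  exists tau : 'rV[int]_d -> R, lattice_gauss_sum B s t =
    (\esum_(z in [set: 'rV[int]_d])
     \esum_(m in [set: int])
       ((s ^+ d * expR (- (qform (schur B) (s *: map_mx intr z + rsubmx t) /
         2)))%:E *
        (s * expR (- (B 0 0 / 2 * (s * m%:~R + tau z) ^+ 2)))%:E))%E.
Proof.
move=> Bs Bp s0.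
exists (fun z => t 0 0 +
   (B 0 0)^-1 * ((s *: map_mx intr z + rsubmx t) *m (ursubmx B)^T) 0 0).
rewrite esum_esum; last first.
  by move=> i j _ _; rewrite -EFinM lee_fin !mulr_ge0 ?expR_ge0 ?exprn_ge0.
rewrite /lattice_gauss_sum.
rewrite (reindex_esum ([set: 'rV[int]_d] `*`` (fun=> [set: int])) setT
  (fun k => row_mx (k.2)%:M k.1)); last first.
  split => //.
    move=> [x1 x2] [y1 y2] _ _ /= /eq_row_mx[/(congr1 (fun M : 'M[int]_1 => M 0
      0))].
    by rewrite !mxE/= !mulr1n => -> ->.
  move=> y _; exists (rsubmx (y : 'rV[_]_(1 + d)), lsubmx (y : 'rV[_]_(1 + d))
    0 0) => //=.
  by rewrite -mx11_scalar hsubmxK.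
apply: eq_esum => -[z m] _ /=.
have -> : s *: map_mx intr (row_mx m%:M z) + t =
    row_mx (s * m%:~R + t 0 0)%:M (s *: map_mx intr z + rsubmx t).
  rewrite map_row_mx scale_row_mx -[t in LHS]hsubmxK add_row_mx; congr row_mx.
  rewrite [lsubmx t]mx11_scalar map_scalar_mx /= scale_scalar_mx -raddfD /=.
  congr (_%:M); rewrite !mxE; congr (_ + t _ _); exact/val_inj.
rewrite complete_square// -EFinM; congr EFin.
rewrite exprD expr1 mulrACA -expRD [s * s ^+ d]mulrC; congr (_ * expR _).
rewrite -[X in X ^+ 2]addrA; set p := (s * _ + _); set q := qform _ _; by field.
Qed.

(** Completing the square
    in the first coordinate turns the sum over the fibre of the projection to
    the other coordinates into a shifted one-dimensional sum; since the
    one-dimensional estimate does not depend on the shift, the sum factors up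
    to O(s). *)
Theorem lattice_gauss_sum_cvg (R : realType) (d : nat) (B : 'M[R]_d) :
  B^T = B -> posdefmx B ->
  exists2 C : R, 0 <= C & forall (s : R) t, 0 < s <= 1 ->
    ((lattice_gauss_sum B s t <= (Num.sqrt ((2 * pi) ^+ d / \det B) + C *
      s)%:E) /\
    ((Num.sqrt ((2 * pi) ^+ d / \det B))%:E <=
       lattice_gauss_sum B s t + (C * s)%:E))%E.
Proof.
elim: d B => [|d IH] B Bs Bp.
  exists 0 => // s t _.
  suff -> : lattice_gauss_sum B s t = 1%E.
    by rewrite det_mx00 expr0 divr1 sqrtr1 mul0r addr0 adde0.
  rewrite /lattice_gauss_sum [setT](_ : _ = [set 0]); last first.
    by apply/seteqP; split => // z _; exact: thinmx0.
  rewrite esum_set1 expr0 mul1r.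
    by rewrite /qform mxE big_ord0 mul0r oppr0 expR0.
  by rewrite lee_fin expR_ge0.
have Bs1 := schur_sym Bs.
have Bp1 := schur_posdef Bs Bp.
have [C1 C10 HC1] := IH _ Bs1 Bp1.
have b0 : 0 < B 0 0 := posdef_corner Bs Bp.
have D0 := posdef_det_gt0 Bs1 Bp1.
have twopi0 : 0 <= 2 * pi :> R by rewrite mulr_ge0// pi_ge0.
set a := Num.sqrt (2 * pi / B 0 0).
set L1 := Num.sqrt ((2 * pi) ^+ d / \det (schur B)) in HC1.
have a_gt0 : 0 < a by rewrite sqrtr_gt0 divr_gt0// mulr_gt0// pi_gt0.
have a0 := ltW a_gt0.
have L10 : 0 <= L1 by rewrite sqrtr_ge0.
have -> : Num.sqrt ((2 * pi) ^+ d.+1 / \det B) = a * L1.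
  rewrite /a /L1 -sqrtrM ?divr_ge0 ?(ltW b0)//; congr Num.sqrt.
  rewrite (@det_schur R d B)// exprS; field.
  by rewrite !gt_eqF.
exists (a * C1 + 2 * L1 + 2 * C1); first by rewrite !addr_ge0 ?mulr_ge0.
move=> s t /[dup] s01 /andP[s0 s1].
have s0le := ltW s0.
have [tau ->] := lattice_gauss_sumS t Bs Bp s0le.
have [hO1 hO2] := HC1 s (rsubmx (t : 'rV[_]_(1 + d))) s01.
pose w (z : 'rV[int]_d) :=
  s ^+ d * expR (- (qform (schur B) (s *: map_mx intr z + rsubmx (t : 'rV[_]_(1
    + d))) / 2)).
pose I z := (\esum_(m in [set: int])
  (s * expR (- (B 0 0 / 2 * (s * m%:~R + tau z) ^+ 2)))%:E)%E.
have w0 z : 0 <= w z by rewrite mulr_ge0 ?expR_ge0 ?exprn_ge0.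
have wgt0 z : 0 < w z by rewrite mulr_gt0 ?expR_gt0 ?exprn_gt0.
have I0 z : (0 <= I z)%E.
  by apply: esum_ge0 => m _; rewrite lee_fin mulr_ge0 ?expR_ge0.
rewrite (eq_esum (b := fun z => ((w z)%:E * I z)%E)); last first.
  move=> z _; rewrite -ge0_esumZl//.
  by move=> m; rewrite lee_fin mulr_ge0 ?expR_ge0.
have OE : lattice_gauss_sum (schur B) s (rsubmx (t : 'rV[_]_(1 + d))) =
  (\esum_(z in [set: 'rV[int]_d]) (w z)%:E)%E by [].
have O0 := lattice_gauss_sum_ge0 (schur B) (rsubmx (t : 'rV[_]_(1 + d))) s0le.
have Ofin : lattice_gauss_sum (schur B) s (rsubmx (t : 'rV[_]_(1 + d))) \is a
  fin_num.
  by rewrite ge0_fin_numE// (le_lt_trans hO1)// ltry.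
move: (OE); rewrite -(fineK Ofin); set o := fine _ => OE1.
have o0 : 0 <= o by rewrite fine_ge0.
have o1 : o <= L1 + C1 * s by rewrite -lee_fin fineK.
have o2 : L1 <= o + C1 * s by rewrite -lee_fin EFinD fineK.
have wE0 z : (0 <= (w z)%:E)%E by rewrite lee_fin.
have Cs : C1 * s <= C1 by rewrite ler_piMr.
set S := esum _ _.
have S0 : (0 <= S)%E by apply: esum_ge0 => z _; rewrite mule_ge0.
split.
  apply: (@le_trans _ _ ((a + 2 * s)%:E * o%:E)%E).
    rewrite OE1 -ge0_esumZl//; last by rewrite ltr_wpDl// mulr_gt0.
    apply: le_esum => z _; rewrite muleC lee_pmul2r// ?lte_fin//.
    by have [] := gauss_sum_progression (tau z) b0 s0.
  rewrite -EFinM lee_fin; nra.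
have : (a%:E * o%:E <= S + (2 * s)%:E * o%:E)%E.
  rewrite OE1 -!ge0_esumZl ?mulr_gt0// -esumD//; last 2 first.
  - by move=> z _; rewrite mule_ge0.
  - by move=> z _; rewrite mule_ge0// lee_fin mulr_ge0.
  apply: le_esum => z _.
  rewrite [X in (_ <= _ + X)%E]muleC -ge0_muleDr// ?lee_fin ?mulr_ge0//.
  rewrite muleC lee_pmul2l// ?lte_fin//.
  by have [] := gauss_sum_progression (tau z) b0 s0.
case: S S0 => [S| |]//=; last by move=> _ _; rewrite addye// leey.
rewrite !lee_fin => S0 h; nra.
Qed.

(** * Norm bounds and perturbation of quadratic forms *)

Lemma mx_entry_le_norm (R : realType) m n (M : 'M[R]_(m, n)) i j :
  `|M i j| <= `|M|.
Proof.
rewrite [leRHS]mx_normrE.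
exact: (le_bigmax _ (fun ij : 'I_m * 'I_n => `|M ij.1 ij.2|) (i, j)).
Qed.

Lemma mx_norm_le (R : realType) m n (M : 'M[R]_(m, n)) r :
  0 <= r -> (forall i j, `|M i j| <= r) -> `|M| <= r.
Proof.
by move=> r0 H; rewrite [leLHS]mx_normrE; apply/bigmax_leP; split.
Qed.

Lemma mulmx_norm_le (R : realType) m n p (M : 'M[R]_(m, n)) (N : 'M[R]_(n, p)) :
  `|M *m N| <= n%:R * `|M| * `|N|.
Proof.
apply: mx_norm_le => [|i j]; first by rewrite !mulr_ge0.
rewrite mxE; apply: le_trans (ler_norm_sum _ _ _) _.
rewrite -mulrA mulr_natl -[X in _ *+ X](card_ord n) -sumr_const.
by apply: ler_sum => k _; rewrite normrM ler_pM// mx_entry_le_norm.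
Qed.

Lemma trmx_norm (R : realType) m n (M : 'M[R]_(m, n)) : `|M^T| = `|M|.
Proof.
have le_tr p q (N : 'M[R]_(p, q)) : `|N^T| <= `|N|.
  by apply: mx_norm_le => // i j; rewrite mxE mx_entry_le_norm.
by apply/le_anti; rewrite le_tr -[X in `|X| <= _]trmxK le_tr.
Qed.

Lemma qform_norm_le (R : realType) d (M : 'M[R]_d) u :
  `|qform M u| <= d%:R ^+ 2 * `|M| * `|u| ^+ 2.
Proof.
apply: le_trans (mx_entry_le_norm _ _ _) _.
apply: le_trans (mulmx_norm_le _ _) _; rewrite trmx_norm.
have := ler_wpM2r (normr_ge0 u) (ler_wpM2l (ler0n R d) (mulmx_norm_le u M)).
rewrite (_ : d%:R * (d%:R * _ * _) * _ = d%:R ^+ 2 * `|M| * `|u| ^+ 2);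
  last by ring.
by [].
Qed.

Lemma qform_continuous (R : realType) d (B : 'M[R]_d) :
  continuous (qform B : 'rV[R]_d -> R).
Proof.
move=> u; rewrite (_ : qform B = fun u => \sum_j (\sum_i u 0 i * B i j) * u 0
  j); last first.
  by apply/funext => w; rewrite qformE.
apply: (@cvg_big R _ +%R 0 xpredT _ _ (nbhs u) _ _ _ (nbhs_filter u)) => [|j
  _]; [exact: add_continuous|].
apply: cvgM; last exact: coord_continuous.
apply: (@cvg_big R _ +%R 0 xpredT _ _ (nbhs u) _ _ _ (nbhs_filter u)) => [|i
  _]; [exact: add_continuous|].
by apply: cvgMr_tmp; exact: coord_continuous.
Qed.

Lemma qform0 (R : realType) d (B : 'M[R]_d) : qform B 0 = 0.
Proof. by rewrite /qform !mul0mx mxE. Qed.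

(** Compactness of the unit sphere. *)
Lemma posdef_lower (R : realType) d (B : 'M[R]_d) : posdefmx B ->
  exists2 l : R, 0 < l & forall u, l * `|u| ^+ 2 <= qform B u.
Proof.
case: d B => [|d] B Bpos.
  by exists 1 => // u; rewrite (thinmx0 u) normr0 qform0 expr0n mulr0.
pose S : set 'rV[R]_d.+1 := [set u | `|u| = 1].
have S0 : S !=set0.
  exists (const_mx 1); apply/le_anti/andP; split.
    by apply: mx_norm_le => // i j; rewrite mxE normr1.
  by have := mx_entry_le_norm (const_mx 1 : 'rV[R]_d.+1) 0 0;
    rewrite mxE normr1.
have cS : compact S.
  apply: bounded_closed_compact.
    by exists 1; split => // M M1 u /= ->; exact: ltW.
  by apply: (@closed_comp _ _ (fun u : 'rV[R]_d.+1 => `|u|) [set 1]) => [u _|];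
    [exact: norm_continuous|exact: closed_eq].
have [u0 Su0 umin] := EVT_min_rV S0 cS
  (continuous_subspaceT (@qform_continuous R d.+1 B)).
rewrite inE /S /= in Su0.
exists (qform B u0).
  by apply: Bpos; rewrite -normr_gt0 Su0.
move=> u; have [->|un0] := eqVneq u 0.
  by rewrite normr0 qform0 expr0n mulr0.
have nu : 0 < `|u| by rewrite normr_gt0.
have /umin : (`|u|^-1 *: u) \in S.
  by rewrite inE /S/= normrZ normfV normr_id mulVf// gt_eqF.
rewrite qform_scale -ler_pdivrMl ?invr_gt0 ?exprn_gt0// ?invr_gt0//.
by rewrite exprVn invrK mulrC.
Qed.

(** The error is quadratic in u with a small coefficient, and the positive form
    dominates the squared norm, so that the error is relative to the form. *)
Lemma qform_perturb (R : realType) d (H A : 'M[R]_d) (e : R) :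
  posdefmx (A^T *m H *m A) -> 0 < e ->
  exists2 del : R, 0 < del & forall (M : 'M[R]_d) u, `|M - A| < del ->
    `|qform H (u *m M^T) - qform (A^T *m H *m A) u|
      <= e * qform (A^T *m H *m A) u.
Proof.
move=> /posdef_lower[l l0 Hl] e0.
pose K := d%:R ^+ 2 * (d%:R ^+ 2 * `|H| * (2 * `|A| + 1)) + 1.
have K0 : 0 < K.
  by rewrite ltr_wpDl// !mulr_ge0 ?exprn_ge0// addr_ge0// mulr_ge0.
exists (Num.min 1 (e * l / K)); first by rewrite lt_min ltr01 divr_gt0//
  mulr_gt0.
move=> M u; rewrite lt_min => /andP[M1 MK].
have MA : `|M| <= `|A| + 1.
  by rewrite -[M](subrK A) addrC (le_trans (ler_normD _ _))// lerD2l ltW.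
have -> : qform H (u *m M^T) - qform (A^T *m H *m A) u =
    qform ((M - A)^T *m H *m M + A^T *m H *m (M - A)) u.
  rewrite (_ : _ + _ = M^T *m H *m M - A^T *m H *m A); last first.
    by rewrite linearB /= !mulmxBl mulmxBr addrA subrK.
  by rewrite /qform mulmxBr mulmxBl !trmx_mul !trmxK [RHS]mxE [X in _ = _ +
    X]mxE !mulmxA.
apply: le_trans (qform_norm_le _ _) _.
apply: le_trans (_ : K * `|M - A| * `|u| ^+ 2 <= _); last first.
  apply: le_trans (ler_wpM2l (ltW e0) (Hl u)).
  rewrite [leRHS]mulrA; apply: ler_wpM2r; first by rewrite exprn_ge0.
  by rewrite mulrC -ler_pdivlMr// ltW.
apply: ler_wpM2r; first by rewrite exprn_ge0.
have d0 : 0 <= d%:R :> R by [].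
have h1 : `|(M - A)^T *m H *m M| <= d%:R ^+ 2 * `|M - A| * `|H| * `|M|.
  apply: le_trans (mulmx_norm_le _ _) _; apply: ler_wpM2r => //.
  apply: le_trans (ler_wpM2l d0 (mulmx_norm_le _ _)) _.
  by rewrite trmx_norm expr2 !mulrA.
have h2 : `|A^T *m H *m (M - A)| <= d%:R ^+ 2 * `|A| * `|H| * `|M - A|.
  apply: le_trans (mulmx_norm_le _ _) _; apply: ler_wpM2r => //.
  apply: le_trans (ler_wpM2l d0 (mulmx_norm_le _ _)) _.
  by rewrite trmx_norm expr2 !mulrA.
have h3 : d%:R ^+ 2 * `|M - A| * `|H| * `|M| <= d%:R ^+ 2 * `|M - A| * `|H| *
  (`|A| + 1).
  by rewrite ler_wpM2l// !mulr_ge0.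
apply: (@le_trans _ _ (d%:R ^+ 2 * (d%:R ^+ 2 * `|M - A| * `|H| * (`|A| + 1) +
   d%:R ^+ 2 * `|A| * `|H| * `|M - A|))).
  rewrite ler_wpM2l ?exprn_ge0//; apply: le_trans (ler_normD _ _) _.
  by rewrite lerD// (le_trans h1).
rewrite /K mulrDl mul1r.
set x := `|M - A|.
have -> : d%:R ^+ 2 * (d%:R ^+ 2 * `|H| * (2 * `|A| + 1)) * x =
  d%:R ^+ 2 * (d%:R ^+ 2 * x * `|H| * (`|A| + 1) +
   d%:R ^+ 2 * `|A| * `|H| * x) :> R by ring.
by rewrite lerDl normr_ge0.
Qed.

(** * Mean value and Taylor bounds from partial derivatives *)

Section lines.
Variables (R : realType) (V : normedModType R).
Implicit Types (F : V -> R) (x v : V).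

Lemma is_derive_line F x v (t : R) : derivable F (t *: v + x) v ->
  is_derive t 1 (fun h : R => F (h *: v + x)) ('D_v F (t *: v + x)).
Proof.
have E : (fun h : R => h^-1 *: (F ((h *: 1 + t) *: v + x) - F (t *: v + x)))
  = (fun h : R => h^-1 *: (F (h *: v + (t *: v + x)) - F (t *: v + x))).
  by apply/funext => h; rewrite addrA -scalerDl [h *: 1]mulr1.
move=> dF; apply: DeriveDef.
  by rewrite /derivable /= E.
by rewrite /derive /= E.
Qed.

Lemma is_derive_translate F x v w : derivable F (x + w) v ->
  is_derive x v (fun y => F (y + w)) ('D_v F (x + w)).
Proof.
have E : (fun h : R => h^-1 *: (F (h *: v + x + w) - F (x + w)))
  = (fun h : R => h^-1 *: (F (h *: v + (x + w)) - F (x + w))).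
  by apply/funext => h; rewrite addrA.
move=> dF; apply: DeriveDef.
  by rewrite /derivable /= E.
by rewrite /derive /= E.
Qed.

(** A difference quotient that is affine in h. It gives the derivatives of the
    linear and quadratic functions of [taylor2_bound]. *)
Lemma is_derive_quadratic F x v (a b : R) :
  (forall h : R, F (h *: v + x) = F x + h * a + h ^+ 2 * b) ->
  is_derive x v F a.
Proof.
move=> HF.
have cvF : h^-1 *: (F (h *: v + x) - F x) @[h --> (0 : R)^'] --> a.
  apply: (@cvg_trans _ (a + h * b @[h --> (0 : R)^'])).
    apply: near_eq_cvg; near=> h.
    have h0 : h != 0 by near: h; exact: nbhs_dnbhs_neq.
    rewrite HF; apply/esym; rewrite [LHS]/GRing.scale /=; field.
    exact: h0.
  have -> : nbhs a = nbhs (a + 0 * b) by rewrite mul0r addr0.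
  apply: cvgD; first exact: cvg_cst.
  by apply: cvgMr_tmp; apply: cvg_within.
apply: DeriveDef; first by apply/cvg_ex; exists a.
exact: cvg_lim cvF.
Unshelve. all: by end_near.
Qed.

Lemma MVT_line F x v (t : R) : 0 < t ->
  (forall s, 0 <= s <= t -> derivable F (s *: v + x) v) ->
  exists2 s, 0 <= s <= t & F (t *: v + x) - F x = t * 'D_v F (s *: v + x).
Proof.
move=> t0 dF.
have dline s : s \in `[0, t] ->
    is_derive s 1 (fun h : R => F (h *: v + x)) ('D_v F (s *: v + x)).
  by rewrite in_itv /= => st; apply: is_derive_line; exact: dF.
have cline : {within `[0, t], continuous (fun h : R => F (h *: v + x))}.
  by apply: derivable_within_continuous => s /dline [].
have oline s : s \in `]0, t[ ->
    is_derive s 1 (fun h : R => F (h *: v + x)) ('D_v F (s *: v + x)).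
  by move=> s0t; apply: dline; exact: subset_itv_oo_cc s0t.
have [c c0t] := MVT t0 oline cline.
rewrite scale0r add0r subr0 mulrC => E; exists c => //.
by have := subset_itv_oo_cc c0t; rewrite in_itv.
Qed.

End lines.

Lemma delta_norm_le (R : realType) d (i : 'I_d) :
  `|delta_mx 0 i : 'rV[R]_d| <= 1.
Proof.
apply: mx_norm_le => // a j; rewrite mxE; case: (_ && _);
  rewrite ?normr1 ?normr0//.
Qed.

Lemma partial_step_le (R : realType) d (F : 'rV[R]_d -> R) x (i : 'I_d) (t M :
  R) :
  (forall s, `|s| <= `|t| -> 0 <= s * t ->
    derivable F (s *: delta_mx 0 i + x) (delta_mx 0 i) /\
    `|partial i F (s *: delta_mx 0 i + x)| <= M) ->
  `|F (t *: delta_mx 0 i + x) - F x| <= `|t| * M.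
Proof.
wlog t0 : t x / 0 < t => [IH|] H.
  have [t0|t0|->] := ltgtP t 0; last 2 first.
  - exact: IH.
  - by rewrite scale0r add0r subrr normr0 mul0r.
  have xE : x = - t *: delta_mx 0 i + (t *: delta_mx 0 i + x).
    by rewrite addrA scaleNr addNr add0r.
  rewrite distrC [X in F X - _]xE -(normrN t); apply: IH;
    first by rewrite oppr_gt0.
  move=> s; rewrite normrN addrA -scalerDl => s1 s2; apply: H.
    rewrite (ltr0_norm t0) in s1 *; move: s1 s2; rewrite ler_norml => /andP[] *.
    by rewrite ler_norml; apply/andP; split; nra.
  by move: s1 s2; rewrite (ltr0_norm t0) ler_norml => /andP[] *; nra.
have [s s0t|s s0t ->] := @MVT_line _ _ F x (delta_mx 0 i) t t0.
  case/andP: s0t => s0 st; apply: (H s _ _).1; last by rewrite mulr_ge0// ltW.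
  by rewrite !ger0_norm// ltW.
rewrite normrM ler_wpM2l//; case/andP: s0t => s0 st.
apply: (H s _ _).2; last by rewrite mulr_ge0// ltW.
by rewrite !ger0_norm// ltW.
Qed.

(** Change one coordinate at a time: each step is a mean value theorem in one
    variable, and in the sup norm the intermediate points are no farther from
    x0 than x is. *)
Lemma partial_mean_value (R : realType) d (F : 'rV[R]_d -> R)
    (x0 x : 'rV[R]_d) M :
  (forall y i, `|y - x0| <= `|x - x0| ->
    derivable F y (delta_mx 0 i) /\ `|partial i F y| <= M) ->
  `|F x - F x0| <= d%:R * M * `|x - x0|.
Proof.
move=> H.
pose y j : 'rV[R]_d := \row_i (if (i < j)%N then x 0 i else x0 0 i).
suff key j : (j <= d)%N -> `|F (y j) - F x0| <= j%:R * M * `|x - x0|.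
  suff yd : y d = x by have := key d (leqnn d); rewrite yd.
  by apply/rowP => i; rewrite mxE ltn_ord.
elim: j => [_|j IH jd].
  rewrite (_ : y 0%N = x0); last by apply/rowP => i; rewrite mxE ltn0.
  by rewrite subrr normr0 !mul0r.
pose i := Ordinal jd; pose t := x 0 i - x0 0 i.
have yS : y j.+1 = t *: delta_mx 0 i + y j.
  apply/rowP => a; rewrite !mxE eqxx /= ltnS leq_eqVlt.
  have [->|ai] := eqVneq a i.
    by rewrite eqxx /= ltnn /t mulr1 subrK.
  rewrite mulr0 add0r; case: eqP => //= aj.
  by case/eqP: ai; exact/val_inj.
have tx : `|t| <= `|x - x0|.
  by have := mx_entry_le_norm (x - x0) 0 i; rewrite !mxE.
have step : `|F (y j.+1) - F (y j)| <= `|t| * M.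
  rewrite yS; apply: partial_step_le => s st s0; apply: H.
  apply: mx_norm_le => // a b; rewrite (ord1 a) !mxE eqxx /=.
  have [->|bi] := eqVneq b i.
    by rewrite ltnn mulr1 addrK (le_trans st).
  rewrite mulr0 add0r; case: ifP => _; last by rewrite subrr normr0.
  by have := mx_entry_le_norm (x - x0) 0 b; rewrite !mxE.
have M0 : 0 <= M.
  apply: le_trans (normr_ge0 (partial i F x0)) _.
  by apply: (H x0 i _).2; rewrite subrr normr0.
have -> : j.+1%:R * M * `|x - x0| = `|x - x0| * M + j%:R * M * `|x - x0|.
  by rewrite -addn1 natrD; ring.
rewrite -(subrKA (F (y j))) (le_trans (ler_normD _ _))//.
by rewrite lerD ?IH ?(ltnW jd)// (le_trans step)// ler_wpM2r.
Qed.

Lemma qformD (R : realType) d (H : 'M[R]_d) u w : H^T = H ->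
  qform H (u + w) = qform H u + 2 * (w *m H *m u^T) 0 0 + qform H w.
Proof.
move=> Hs; rewrite /qform linearD /= !mulmxDl !mulmxDr.
have -> : u *m H *m w^T = (w *m H *m u^T)^T by rewrite !trmx_mul trmxK Hs
  mulmxA.
rewrite !mxE; ring.
Qed.

Lemma mulmx_delta (R : realType) d (w : 'rV[R]_d) i :
  (w *m (delta_mx 0 i : 'rV[R]_d)^T) 0 0 = w 0 i.
Proof. by rewrite trmx_delta -colE mxE. Qed.

(** Apply the mean value inequality first to the gradient of f - q/2, which
    vanishes at x0, and then to f - q/2 itself, where q is the form of H at
    x - x0; each application costs a factor d |x - x0|. *)
Lemma taylor2_bound (R : realType) d (f : 'rV[R]_d -> R) (H : 'M[R]_d)
    (x0 x : 'rV[R]_d) (e : R) :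
  H^T = H -> gradient f x0 = 0 ->
  (forall y, `|y - x0| <= `|x - x0| -> forall i,
     derivable f y (delta_mx 0 i) /\
     forall j, derivable (partial i f) y (delta_mx 0 j) /\
       `|partial j (partial i f) y - H i j| <= e) ->
  `|f x - f x0 - qform H (x - x0) / 2| <= d%:R ^+ 2 * e * `|x - x0| ^+ 2.
Proof.
move=> Hs g0 Hf.
pose p y := f y - qform H (y - x0) / 2.
pose L i (y : 'rV[R]_d) := ((y - x0) *m H) 0 i.
have dL i j y : is_derive y (delta_mx 0 j) (L i) (H i j).
  apply: (@is_derive_quadratic _ _ _ _ _ _ 0) => h.
  rewrite mulr0 addr0 /L -addrA mulmxDl mxE addrC; congr (_ + _).
  by rewrite -scalemxAl mxE -rowE mxE -[in RHS]Hs mxE.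
have dq i y : is_derive y (delta_mx 0 i) (fun y => qform H (y - x0) / 2) (L i
  y).
  apply: (@is_derive_quadratic _ _ _ _ _ _ (H i i / 2)) => h.
  rewrite -addrA; set w := y - x0.
  have -> : qform H (h *: delta_mx 0 i + w) =
      qform H w + 2 * (h * L i y) + h ^+ 2 * H i i.
    rewrite (qformD _ _ Hs) qform_scale linearZ /= -scalemxAr mxE mulmx_delta.
    rewrite [qform H (delta_mx 0 i)]/qform mulmx_delta -rowE [row i H 0 i]mxE
      /L -/w; ring.
  by field.
have dp i y : `|y - x0| <= `|x - x0| ->
    is_derive y (delta_mx 0 i) p (partial i f y - L i y).
  move=> yx; have dfy := derivableP (Hf y yx i).1.
  exact: is_deriveB dfy (dq i y).
have step1 i y : `|y - x0| <= `|x - x0| ->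
    `|partial i f y - L i y| <= d%:R * e * `|y - x0|.
  move=> yx.
  have L0 : L i x0 = 0 by rewrite /L subrr mul0mx mxE.
  have pf0 : partial i f x0 = 0 by move/rowP: g0 => /(_ i); rewrite !mxE.
  have := @partial_mean_value R d (partial i f \- L i) x0 y e.
  rewrite /= L0 pf0 !subr0; apply => w j wy.
  have [dfw /(_ j)[d2f le_e]] := Hf w (le_trans wy yx) i.
  have dd : is_derive w (delta_mx 0 j) (partial i f \- L i)
      (partial j (partial i f) w - H i j).
    by apply: is_deriveB => //; exact: derivableP.
  split; first by case: dd.
  by rewrite /partial derive_val.
have := @partial_mean_value R d p x0 x (d%:R * e * `|x - x0|).
rewrite /p subrr qform0 mul0r subr0 addrAC.
rewrite (_ : d%:R * (d%:R * e * `|x - x0|) * `|x - x0| = d%:R ^+ 2 * e * `|x -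
  x0| ^+ 2); last by ring.
apply => y i yx; split; first by case: (dp i y yx).
rewrite /partial; have := dp i y yx; rewrite /p => dpy; rewrite derive_val.
apply: le_trans (step1 i y yx) _; rewrite ler_wpM2l//.
have e0 : 0 <= e.
  by apply: le_trans (normr_ge0 _) ((Hf y yx i).2 i).2.
by rewrite mulr_ge0.
Qed.

(** * Symmetry of the Hessian and uniform quadratic approximation *)

Lemma within_open_continuous (T U : topologicalType) (N : set T) (F : T -> U)
    x :
  open N -> N x -> {within N, continuous F} -> {for x, continuous F}.
Proof.
by move=> oN Nx; rewrite continuous_open_subspace// => /(_ x); apply;
  rewrite inE.
Qed.

Lemma double_difference (R : realType) d (f : 'rV[R]_d -> R) x0 i j (a : R) :
  0 < a ->
  (forall s s', 0 <= s <= a -> 0 <= s' <= a ->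
    let y := s' *: delta_mx 0 j + (s *: delta_mx 0 i + x0) in
    derivable f y (delta_mx 0 i) /\ derivable (partial i f) y (delta_mx 0 j)) ->
  exists s s', [/\ 0 <= s <= a, 0 <= s' <= a &
    f (a *: delta_mx 0 i + a *: delta_mx 0 j + x0) - f (a *: delta_mx 0 i + x0)
      - f (a *: delta_mx 0 j + x0) + f x0 =
    a ^+ 2 * partial j (partial i f) (s' *: delta_mx 0 j + (s *: delta_mx 0 i +
      x0))].
Proof.
move=> a0 Hf.
set ei := delta_mx 0 i; set ej := delta_mx 0 j.
have z0a : 0 <= (0 : R) <= a by rewrite lexx ltW.
have zaa : 0 <= a <= a by rewrite lexx ltW.
pose G y := f (y + a *: ej) - f y.
have dG s : 0 <= s <= a -> is_derive (s *: ei + x0) ei G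
    (partial i f (s *: ei + x0 + a *: ej) - partial i f (s *: ei + x0)).
  move=> sa; have [+ _] := Hf s a sa zaa.
  rewrite /= -/ei -/ej [a *: ej + _]addrC => /is_derive_translate d1.
  have [+ _] := Hf s 0 sa z0a.
  rewrite /= scale0r add0r => /derivableP d2.
  exact: is_deriveB d1 d2.
have [s sa|s sa GE] := @MVT_line R _ G x0 ei a a0; first by case: (dG s sa).
have [s' sa'|s' sa' E] := @MVT_line R _ (partial i f) (s *: ei + x0) ej a a0.
  by case: (Hf s s' sa sa').
exists s, s'; split => //.
have dGs := dG s sa.
move: GE; rewrite derive_val [s *: ei + x0 + _]addrC E /G => GE.
rewrite expr2 -mulrA -/(partial _ _ _) -GE.
rewrite [x0 + _]addrC -[a *: ei + a *: ej + x0]addrA [a *: ej + x0]addrC addrA;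
  ring.
Qed.

(** The same double difference is a^2 times a value, near x0, of either mixed
    derivative. *)
Lemma hessian_sym (R : realType) d (N : set 'rV[R]_d) (f : 'rV[R]_d -> R) x0 :
  open N -> N x0 -> C2_on N f -> (hessian f x0)^T = hessian f x0.
Proof.
move=> oN Nx0 [_ df _ d2f c2f]; apply/matrixP => i j; rewrite !mxE.
apply/eqP; rewrite -subr_eq0 -normr_le0; apply/ler_addgt0Pr => e e0;
  rewrite add0r.
have near_d2 p q : \forall y \near x0,
    N y /\ `|partial q (partial p f) y - partial q (partial p f) x0| < e / 2.
  apply: filterI; first exact: open_nbhs_nbhs.
  have /cvgrPdistC_lt cpq := within_open_continuous oN Nx0 (c2f p q).
  by apply: cpq; rewrite divr_gt0.
have [r /= r0 rP] := (nbhs_ballP _ _).1 (filterI (near_d2 i j) (near_d2 j i)).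
(* A third of the radius keeps the square of side a inside the ball. *)
pose a := r / 3.
have a0 : 0 < a by rewrite divr_gt0.
have in_ball (p q : 'I_d) s s' : 0 <= s <= a -> 0 <= s' <= a ->
    ball x0 r (s' *: delta_mx 0 q + (s *: delta_mx 0 p + x0)).
  move=> /andP[s0 sa] /andP[s'0 s'a]; rewrite -ball_normE /= addrA opprD addrCA
    subrr addr0.
  rewrite normrN (le_lt_trans (ler_normD _ _))// !normrZ !ger0_norm//.
  apply: (@le_lt_trans _ _ (s' * 1 + s * 1)).
    by rewrite lerD// ler_wpM2l// delta_norm_le.
  by rewrite /a in sa s'a; lra.
have [|s [s' [sa sa' E]]] := @double_difference R d f x0 i j a a0.
  move=> s s' sa sa'; have [[Ny _] _] := rP _ (in_ball i j _ _ sa sa').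
  by split; [apply: df|apply: d2f]; rewrite inE.
have [|t [t' [ta ta' E']]] := @double_difference R d f x0 j i a a0.
  move=> s1 s1' sa1 sa1'; have [[Ny _] _] := rP _ (in_ball j i _ _ sa1 sa1').
  by split; [apply: df|apply: d2f]; rewrite inE.
have [_ [_ h1]] := rP _ (in_ball j i _ _ ta ta').
have [[_ h2] _] := rP _ (in_ball i j _ _ sa sa').
set u := partial j (partial i f) _ in E h2 *;
  set w := partial i (partial j f) _ in E' h1 *.
clearbody u w.
have uw : u = w.
  apply: (mulfI (_ : a ^+ 2 != 0)); first by rewrite expf_neq0// gt_eqF.
  by rewrite -E -E' [a *: delta_mx 0 j + a *: delta_mx 0 i]addrC;
    congr (_ + _); rewrite addrAC.
rewrite {}uw in h2; move: h1 h2 {E E'}.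
move: (partial j (partial i f) x0) (partial i (partial j f) x0) => p q.
rewrite !ltr_norml => /andP[? ?] /andP[? ?].
by rewrite ler_norml; apply/andP; split; lra.
Qed.

Lemma supnorm_ub (R : realType) T (S : set T) (f : T -> R) e x :
  (supnorm S f <= e%:E)%E -> S x -> `|f x| <= e.
Proof.
rewrite /supnorm ge_max => /andP[_ h] Sx; rewrite -lee_fin; apply: le_trans h.
by apply: ereal_sup_ubound; exists x.
Qed.

Lemma C2_norm_partial2 (R : realType) d (N : set 'rV[R]_d) (f : 'rV[R]_d -> R)
  e x i j :
  (C2_norm N f <= e%:E)%E -> N x -> `|partial j (partial i f) x| <= e.
Proof.
rewrite /C2_norm !ge_max => /andP[_ /andP[_ h]]; apply: supnorm_ub.
apply: le_trans h; apply: le_trans (le_bigmax _ _ i).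
exact: (le_bigmax _ (fun j => supnorm N (partial j (partial i f))) j).
Qed.

Lemma partial2B (R : realType) d (N : set 'rV[R]_d) (f g : 'rV[R]_d -> R) x i j
  :
  open N -> N x -> C2_on N f -> C2_on N g ->
  partial j (partial i (f \- g)) x =
  partial j (partial i f) x - partial j (partial i g) x.
Proof.
move=> oN Nx [_ df _ d2f _] [_ dg _ d2g _].
have inN y : N y -> y \in N by rewrite inE.
rewrite /partial -deriveB; [|exact: d2f (inN _ Nx)|exact: d2g (inN _ Nx)].
apply: near_eq_derive; near=> y.
have Ny : N y by near: y; exact: open_nbhs_nbhs.
by rewrite deriveB; [|exact: df (inN _ Ny)|exact: dg (inN _ Ny)].
Unshelve. all: by end_near.
Qed.

(** The second derivatives of h_k are uniformly close to those of h, and these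
    are close to the Hessian at x0 on a small ball: [taylor2_bound] applies with
    the same ball and the same matrix to all large k. *)
Lemma local_quadratic (R : realType) d (N0 : set 'rV[R]_d)
    (h_ : nat -> 'rV[R]_d -> R) (h : 'rV[R]_d -> R) x0 (e : R) :
  open N0 -> N0 x0 -> (forall k, (0 < k)%N -> C2_on N0 (h_ k)) -> C2_on N0 h ->
  C2_norm N0 (h_ k \- h) @[k --> \oo] --> 0%E ->
  (forall k, (0 < k)%N -> h_ k x0 = h x0) ->
  (forall k, (0 < k)%N -> gradient (h_ k) x0 = 0) ->
  0 < e ->
  exists2 r : R, 0 < r & ball x0 r `<=` N0 /\ \forall k \near \oo, forall x,
    ball x0 r x ->
    `|h_ k x - h x0 - qform (hessian h x0) (x - x0) / 2| <= e * `|x - x0| ^+ 2.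
Proof.
move=> oN Nx0 hkC2 hC2 hcvg hx0 gx0 e0.
pose e' := e / (d%:R ^+ 2 + 1).
have d1 : 0 < d%:R ^+ 2 + 1 :> R by rewrite ltr_wpDl// exprn_ge0.
have e'0 : 0 < e' by rewrite divr_gt0.
(* Half of e' is spent on the variation of the Hessian of h, half on h_k - h. *)
have near_h : \forall y \near x0, N0 y /\ forall i j,
    `|partial j (partial i h) y - hessian h x0 i j| < e' / 2.
  apply: filterI; first exact: open_nbhs_nbhs.
  have [_ _ _ _ c2] := hC2.
  pose P i j y := `|partial j (partial i h) y - hessian h x0 i j| < e' / 2.
  apply: (@filter_forall _ 'I_d (fun i y => forall j, P i j y) _ (nbhs_filter
    x0)) => i.
  apply: (@filter_forall _ 'I_d (P i) _ (nbhs_filter x0)) => j; rewrite /P mxE.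
  have /cvgrPdistC_lt cij := within_open_continuous oN Nx0 (c2 i j).
  by apply: cij; rewrite divr_gt0.
have [r /= r0 rP] := (nbhs_ballP _ _).1 near_h.
exists r => //; split; first by move=> y /rP[].
have : \forall k \near \oo, (C2_norm N0 (h_ k \- h)%R < (e' / 2)%:E)%E.
  have /= := hcvg [set y | (y < (e' / 2)%:E)%E]; apply.
  by apply: open_nbhs_nbhs; split; [exact: open_ereal_lt_ereal|rewrite /=
    lte_fin divr_gt0].
move=> hk; near=> k => x xr.
have k0 : (0 < k)%N by near: k; exists 1%N.
have Hk : (C2_norm N0 (h_ k \- h)%R <= (e' / 2)%:E)%E by apply: ltW; near: k.
have hs : (hessian h x0)^T = hessian h x0 by exact: hessian_sym hC2.
rewrite -(hx0 k k0).
apply: le_trans (@taylor2_bound R d (h_ k) (hessian h x0) x0 x e' hs (gx0 k k0)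
  _) _.
  move=> y yx i.
  have [Ny /(_ i) hij] : N0 y /\ forall i j,
      `|partial j (partial i h) y - hessian h x0 i j| < e' / 2.
    by apply: rP; rewrite -ball_normE /= distrC (le_lt_trans yx)// distrC;
      move: xr; rewrite -ball_normE.
  have [_ dk _ d2k _] := hkC2 k k0.
  have yN : y \in N0 by rewrite inE.
  split; [exact: dk|move=> j; split; first exact: d2k].
  have := C2_norm_partial2 i j Hk Ny.
  rewrite (partial2B i j oN Ny (hkC2 k k0) hC2).
  move: (hij j) => {}hij; move: hij.
  move: (partial j (partial i h) y) (partial j (partial i (h_ k)) y) => p q.
  move=> /ltW pH qp; rewrite (splitr e').
  by rewrite -(subrKA p) (le_trans (ler_normD _ _))// lerD.
rewrite ler_wpM2r ?exprn_ge0// /e' mulrA ler_pdivrMr// mulrDr mulr1 mulrC.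
by rewrite lerDl ltW.
Unshelve. all: by end_near.
Qed.

(** * Sums of exponential weights over lattice points *)

Lemma finite_bounded_int (R : realType) d (K : R) :
  finite_set [set z : 'rV[int]_d | `|map_mx intr z : 'rV[R]_d| <= K].
Proof.
pose N := (Num.truncn K).+1.
pose f (c : {ffun 'I_d -> 'I_(2 * N).+1}) : 'rV[int]_d := \row_i ((c i)%:Z -
  N%:Z).
apply: (@sub_finite_set _ _ (f @` setT)); last exact/finite_image/finite_finset.
move=> z /= zK.
have zN i : `|z 0 i| <= N%:Z.
  have : `|(z 0 i)%:~R| <= K :> R.
    by apply: le_trans zK; have := mx_entry_le_norm (map_mx intr z : 'rV[R]_d)
      0 i; rewrite mxE.
  move=> zi; rewrite -(ler_int R) -[N%:Z%:~R]/(N%:R) intr_norm (le_trans zi)//.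
  by rewrite ltW// truncnS_gt.
have zNn i : (absz (z 0 i + N%:Z)%R < (2 * N).+1)%N.
  by have := zN i; lia.
exists [ffun i => Ordinal (zNn i)] => //.
apply/rowP => i; rewrite mxE ffunE /=; by have := zN i; lia.
Qed.

Lemma subset_esum (R : realType) (T : choiceType) (A B : set T) (a : T -> \bar
  R) :
  A `<=` B -> (forall x, 0 <= a x)%E ->
  (\esum_(x in A) a x <= \esum_(x in B) a x)%E.
Proof.
move=> AB a0; rewrite (esumID A B)// (setIidr AB) leeDl//.
by apply: esum_ge0 => x _.
Qed.

Section lattice_point_sums.
Variables (R : realType) (d n : nat) (M : 'M[R]_d) (v x0 : 'rV[R]_d).
Hypotheses (n0 : (0 < n)%N) (Mu : M \in unitmx).

Let s : R := (Num.sqrt n%:R)^-1.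
Let pt (z : 'rV[int]_d) : 'rV[R]_d := n%:R^-1 *: (map_mx intr z *m M^T) + v.

(** In these coordinates the lattice is a shift of n^-1 Z^d. *)
Definition lattice_coord (x : 'rV[R]_d) : 'rV[R]_d := (x - x0) *m invmx M^T.

Lemma lattice_coordK x : lattice_coord x *m M^T = x - x0.
Proof. by rewrite mulmxKV// unitmx_tr. Qed.

Let nR : 0 < n%:R :> R. Proof. by rewrite ltr0n. Qed.
Let nRn0 : n%:R != 0 :> R. Proof. by rewrite gt_eqF. Qed.

Let pt_inj : injective pt.
Proof.
move=> z z' /addIr /(scalerI (invr_neq0 nRn0)) /(congr1 (mulmx^~ (invmx M^T))).
rewrite !mulmxK ?unitmx_tr// => /rowP e; apply/rowP => i.
by have := e i; rewrite !mxE => /intr_inj.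
Qed.

Lemma finite_lattice (W : set 'rV[R]_d) : bounded_set W ->
  finite_set (W `&` lattice n M v).
Proof.
move=> [K [_ /(_ (K + 1))]]; rewrite ltrDl ltr01 => /(_ isT) W1.
have := @finite_bounded_int R d (n%:R * (d%:R * (K + 1 + `|v|) * `|invmx M^T|)).
move=> /(finite_image pt); apply: sub_finite_set => x [Wx [z xz]].
exists z => //=; rewrite -/(pt z) in xz.
have -> : map_mx intr z = n%:R *: ((x - v) *m invmx M^T) :> 'rV[R]_d.
  by rewrite xz /pt addrK -scalemxAl mulmxK ?unitmx_tr// scalerA divff//
    scale1r.
rewrite normrZ normr_nat ler_wpM2l//; apply: le_trans (mulmx_norm_le _ _) _.
rewrite ler_wpM2r// ler_wpM2l// (le_trans (ler_normB _ _))// lerD2r.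
exact: W1.
Qed.

Let t : 'rV[R]_d := s^-1 *: ((v - x0) *m invmx M^T).

Definition weight (phi : 'rV[R]_d -> R) (x : 'rV[R]_d) : R :=
  s ^+ d * expR (- (n%:R * phi x)).

Lemma weight_ge0 phi x : 0 <= weight phi x.
Proof. by rewrite mulr_ge0 ?expR_ge0// exprn_ge0// invr_ge0. Qed.

(** Scaling the lattice coordinates by sqrt n turns n q into q and the mesh 1/n
    into s = n^(-1/2). *)
Lemma lattice_gauss_sumE (B : 'M[R]_d) : lattice_gauss_sum B s t =
  (\esum_(x in lattice n M v)
     (weight (fun x => qform B (lattice_coord x) / 2) x)%:E)%E.
Proof.
have -> : lattice n M v = pt @` setT.
  by apply/seteqP; split => [x [z ->]|_ [z _ <-]]; exists z.
rewrite esum_image; last by move=> ? ? _ _; exact: pt_inj.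
apply: eq_esum => z _; rewrite /weight; congr (_ * expR (- _))%:E.
have s0 : s != 0 by rewrite invr_neq0// gt_eqF// sqrtr_gt0.
have sn : s ^+ 2 * n%:R = 1.
  by rewrite exprVn sqr_sqrtr ?ler0n// mulVf.
have -> : s *: map_mx intr z + t = s^-1 *: lattice_coord (pt z).
  have -> : lattice_coord (pt z) =
      n%:R^-1 *: map_mx intr z + (v - x0) *m invmx M^T.
    by rewrite /lattice_coord /pt -addrA mulmxDl -scalemxAl mulmxK ?unitmx_tr.
  rewrite scalerDr scalerA; congr (_ *: _ + _).
  apply: (mulfI s0); rewrite mulrA divff// mul1r.
  by apply: (mulIf nRn0); rewrite mulVf// -expr2.
rewrite qform_scale mulrA; congr (_ * _ / _).
by rewrite exprVn; apply: (mulfI (_ : s ^+ 2 != 0));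
  rewrite ?sn ?divff ?expf_neq0.
Qed.

Let weight_shift (k : R) (phi psi : 'rV[R]_d -> R) x : k + psi x <= phi x ->
  weight phi x <= expR (- (n%:R * k)) * weight psi x.
Proof.
move=> h; rewrite /weight mulrCA ler_wpM2l//.
  by rewrite exprn_ge0// invr_ge0.
by rewrite -expRD ler_expR -opprD lerN2 -mulrDr ler_wpM2l.
Qed.

Variable phi : 'rV[R]_d -> R.

Let sum_esum (S : set 'rV[R]_d) : finite_set S ->
  ((\sum_(x \in S) weight phi x)%:E = \esum_(x in S) (weight phi x)%:E)%E.
Proof.
move=> fS; rewrite esum_fset ?fsumEFin// => x _.
by rewrite lee_fin weight_ge0.
Qed.

(** Any partial sum is at most the sum over the whole lattice, so neither the
    shape of S nor the number of its points matters. *)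
Lemma lattice_sum_le (B : 'M[R]_d) (k : R) (S : set 'rV[R]_d) :
  finite_set S -> S `<=` lattice n M v ->
  (forall x, S x -> k + qform B (lattice_coord x) / 2 <= phi x) ->
  ((\sum_(x \in S) weight phi x)%:E <=
    (expR (- (n%:R * k)))%:E * lattice_gauss_sum B s t)%E.
Proof.
move=> fS SL h; rewrite sum_esum// lattice_gauss_sumE -ge0_esumZl ?expR_gt0//;
  last first.
  by move=> x; rewrite lee_fin weight_ge0.
apply: (@le_trans _ _ (\esum_(x in S) ((expR (- (n%:R * k)))%:E *
    (weight (fun x => qform B (lattice_coord x) / 2) x)%:E))%E).
  by apply: le_esum => x Sx; rewrite -EFinM lee_fin weight_shift//; exact: h.
by apply: subset_esum => // x; rewrite mule_ge0// lee_fin ?expR_ge0 ?weight_ge0.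
Qed.

(** Outside U the exponent of B pays for both a factor
    exp(-n k) and the exponent of B', whose sum over the whole lattice is still
    bounded. *)
Lemma lattice_sum_ge (B B' : 'M[R]_d) (k : R) (U : set 'rV[R]_d) :
  finite_set (U `&` lattice n M v) ->
  (forall x, U x -> lattice n M v x ->
    phi x <= qform B (lattice_coord x) / 2) ->
  (forall x, ~ U x ->
    k + qform B' (lattice_coord x) / 2 <= qform B (lattice_coord x) / 2) ->
  (lattice_gauss_sum B s t <=
   (\sum_(x \in U `&` lattice n M v) weight phi x)%:E +
   (expR (- (n%:R * k)))%:E * lattice_gauss_sum B' s t)%E.
Proof.
move=> fS hU hUC; rewrite sum_esum// !lattice_gauss_sumE.
have w0 psi x : (0 <= (weight psi x)%:E)%E by rewrite lee_fin weight_ge0.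
rewrite (esumID U)// -ge0_esumZl ?expR_gt0//; apply: leeD.
  rewrite setIC; apply: le_esum => x [Ux Lx]; rewrite lee_fin.
  rewrite /weight ler_wpM2l ?exprn_ge0 ?invr_ge0// ler_expR lerN2 ler_wpM2l//.
  exact: hU.
apply: (@le_trans _ _ (\esum_(x in lattice n M v `&` ~` U) ((expR (- (n%:R *
  k)))%:E *
    (weight (fun x => qform B' (lattice_coord x) / 2) x)%:E))%E); last first.
  by apply: subset_esum => [x []//|x]; rewrite mule_ge0// lee_fin expR_ge0.
apply: le_esum => x [_ Ux]; rewrite -EFinM lee_fin.
by apply: weight_shift; exact: hUC.
Qed.

End lattice_point_sums.

(** * Mass far from and close to the critical point *)

(** The inequality 1 + y <= exp y at y = m c / (l + 1), raised to the power
    l + 1, bounds m^l exp(-m c) by a constant over m. *)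
Lemma poly_exp_small (R : realType) (l : nat) (c e : R) : 0 < c -> 0 < e ->
  exists M : R, forall m : nat, M < m%:R -> m%:R ^+ l * expR (- (m%:R * c)) < e.
Proof.
move=> c0 e0; pose K := (l.+1%:R / c) ^+ l.+1.
have K0 : 0 < K by rewrite exprn_gt0// divr_gt0.
exists (K / e) => m mM.
have m0 : 0 < m%:R :> R by apply: le_lt_trans mM; rewrite divr_ge0// ltW.
apply: (@le_lt_trans _ _ (K / m%:R)); last by rewrite ltr_pdivrMr// mulrC
  -ltr_pdivrMr.
rewrite ler_pdivlMr// mulrAC -exprSr expRN ler_pdivrMr ?expR_gt0//.
have -> : m%:R * c = (m%:R * c / l.+1%:R) * l.+1%:R by rewrite divfK//
  pnatr_eq0.
rewrite expRM_natr /K -exprMn lerXn2r ?nnegrE ?mulr_ge0 ?divr_ge0 ?expR_ge0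
  ?invr_ge0 ?(ltW m0) ?(ltW c0)//.
have lc : 0 <= l.+1%:R / c by rewrite divr_ge0// ltW.
apply: le_trans _ (ler_wpM2l lc (expR_ge1Dx _)).
rewrite mulrDr mulr1 ler_wpDl//.
rewrite le_eqVlt; apply/orP; left; apply/eqP; field.
by rewrite nat1r pnatr_eq0 (gt_eqF c0).
Qed.

Lemma posdefZ (R : realType) d (B : 'M[R]_d) (c : R) :
  0 < c -> posdefmx B -> posdefmx (c *: B).
Proof.
move=> c0 Bp u un0; rewrite -/(qform _ _) qform_scalemx mulr_gt0//; exact: Bp.
Qed.

(** Continuity of c |-> det (c B) at 1. It absorbs the factors 1 + th and 1 - th
    between which the exponent is squeezed in [local_mass]. *)
Lemma gauss_value_scale (R : realType) d (B : 'M[R]_d) (e : R) :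
  0 < \det B -> 0 < e ->
  exists2 th : R, 0 < th < 1 & forall c, `|c - 1| <= th ->
    `|Num.sqrt ((2 * pi) ^+ d / \det (c *: B))
      - Num.sqrt ((2 * pi) ^+ d / \det B)| <= e.
Proof.
move=> B0 e0.
pose F (c : R) := Num.sqrt ((2 * pi) ^+ d / \det (c *: B)).
have Fc : F c @[c --> (1 : R)] --> F 1.
  apply: (cvg_comp (fun c : R => (2 * pi) ^+ d / \det (c *: B)) (@Num.sqrt R));
    last exact: sqrt_continuous.
  apply: cvgMl_tmp; apply: cvgV; first by rewrite scale1r gt_eqF.
  under eq_fun do rewrite detZ.
  by rewrite detZ; apply: cvgMr_tmp; exact: exprn_continuous.
have /cvgrPdist_lt /(_ e e0) /nbhs_ballP [r /= r0 rP] := Fc.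
pose th := Num.min (r / 2) (2^-1).
have th0 : 0 < th by rewrite lt_min divr_gt0//= invr_gt0.
exists th.
  by rewrite th0 gt_min invf_lt1 ?ltr1n ?orbT.
move=> c cth; have /rP : ball (1 : R) r c.
  rewrite -ball_normE /= distrC (le_lt_trans cth)// gt_min.
  by rewrite ltr_pdivrMr// mulr_natr mulr2n ltrDl r0.
by rewrite /F /= scale1r distrC => /ltW.
Qed.

(** A change of basis close to A is invertible, since it cannot kill a vector
    without annihilating the form. Passing to lattice coordinates replaces the
    moving basis by a fixed quadratic form, at the price of a relative error. *)
Lemma qform_lattice_coord (R : realType) d (H A : 'M[R]_d) (e : R) :
  posdefmx (A^T *m H *m A) -> 0 < e < 1 ->
  exists2 del : R, 0 < del & forall M : 'M[R]_d, `|M - A| < del ->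
    M \in unitmx /\ forall x0 x,
    `|qform H (x - x0) - qform (A^T *m H *m A) (lattice_coord M x0 x)|
      <= e * qform (A^T *m H *m A) (lattice_coord M x0 x).
Proof.
move=> Bp /andP[e0 e1]; have [del del0 Hd] := qform_perturb Bp e0.
exists del => // M MA.
have Mu : M \in unitmx.
  rewrite -unitmx_tr unitmxE unitfE; apply/det0P => -[w wn0 w0].
  have := Hd M w MA; rewrite w0 qform0 sub0r normrN.
  have := Bp w wn0; rewrite -/(qform _ _) => q0.
  by rewrite gtr0_norm// leNgt gtr_pMl// e1.
split => // x0 x.
by have := Hd M (lattice_coord M x0 x) MA; rewrite lattice_coordK.
Qed.

Lemma posdef_congr (R : realType) d (H A : 'M[R]_d) :
  A \in unitmx -> posdefmx H -> posdefmx (A^T *m H *m A).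
Proof.
move=> A_inv Hpos u un0; have := Hpos (u *m A^T).
rewrite trmx_mul trmxK !mulmxA; apply.
apply: contra_neq un0 => /(congr1 (mulmx^~ (invmx A^T))).
by rewrite mulmxK ?unitmx_tr// mul0mx.
Qed.

Lemma half_itv (R : realType) : 0 < (2^-1 : R) < 1.
Proof. by rewrite invr_gt0 ltr0n invf_lt1 ?ltr1n. Qed.

Section laplace.
Variables (R : realType) (d : nat) (W : set 'rV[R]_d) (n : nat -> nat).
Variables (v_ : nat -> 'rV[R]_d) (A_ : nat -> 'M[R]_d) (A : 'M[R]_d).
Variables (h_ : nat -> 'rV[R]_d -> R) (h : 'rV[R]_d -> R) (x0 : 'rV[R]_d).
Hypothesis W_bounded : bounded_set W.
Hypothesis n_ge : forall k, (0 < k)%N -> (k <= n k)%N.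
Hypothesis A_cvg : A_ k @[k --> \oo] --> A.
Hypothesis A_inv : A \in unitmx.

Let H := hessian h x0.
Hypothesis Hsym : H^T = H.
Hypothesis Hpos : posdefmx H.

Let B := A^T *m H *m A.
Let La k := lattice (n k) (A_ k) (v_ k).
Let phi k x := h_ k x - h x0.
Let mass k (S : set 'rV[R]_d) := \sum_(x \in S `&` La k) weight (n k) (phi k) x.
Let s_ k : R := (Num.sqrt (n k)%:R)^-1.

Let B_sym : B^T = B.
Proof. by rewrite /B !trmx_mul trmxK Hsym mulmxA. Qed.

Let B_pos : posdefmx B. Proof. exact: posdef_congr. Qed.

Let detB_gt0 : 0 < \det B. Proof. exact: posdef_det_gt0. Qed.

Lemma near_n_gt (M : R) : \forall k \near \oo, M < (n k)%:R.
Proof.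
near=> k; apply: (@lt_le_trans _ _ k%:R); first by near: k;
  exact: nbhs_infty_gtr.
by rewrite ler_nat n_ge//; near: k; exists 1%N.
Unshelve. all: by end_near.
Qed.

Let near_n_gt0 : \forall k \near \oo, (0 < n k)%N.
Proof. by have := near_n_gt 0; apply: filterS => k; rewrite ltr0n. Qed.

Let near_A (del : R) : 0 < del -> \forall k \near \oo, `|A_ k - A| < del.
Proof. by move=> d0; have /cvgrPdistC_lt := A_cvg; apply. Qed.

Let near_s (e : R) : 0 < e -> \forall k \near \oo, 0 < s_ k <= 1 /\ s_ k < e.
Proof.
move=> e0; near=> k.
have n1 : 1 < (n k)%:R :> R by near: k; exact: near_n_gt.
have ne : e^-1 ^+ 2 < (n k)%:R by near: k; exact: near_n_gt.
have sn : 1 <= Num.sqrt (n k)%:R :> R by rewrite -[leLHS]sqrtr1 ler_wsqrtr//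
  ltW.
have sn0 := lt_le_trans ltr01 sn.
rewrite /s_ invr_gt0 sn0 invf_le1// sn; split=> //.
rewrite invf_plt ?posrE//.
rewrite -[ltLHS](@ger0_norm _ e^-1) ?invr_ge0 ?(ltW e0)// -sqrtr_sqr ltr_sqrt//.
exact: lt_trans n1.
Unshelve. all: by end_near.
Qed.

Let near_exp (c e : R) : 0 < c -> 0 < e ->
  \forall k \near \oo, expR (- ((n k)%:R * c)) < e.
Proof.
move=> c0 e0; have [M HM] := poly_exp_small 0 c0 e0.
have := near_n_gt M; apply: filterS => k /HM.
by rewrite expr0 mul1r.
Qed.

Let LB c := Num.sqrt ((2 * pi) ^+ d / \det (c *: B)) : R.

Let L := Num.sqrt ((2 * pi) ^+ d / \det B) : R.

Let scaled_sum c : 0 < c -> exists2 C : R, 0 <= C & forall s t, 0 < s <= 1 ->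
    ((lattice_gauss_sum (c *: B) s t <= (LB c + C * s)%:E) /\
    ((LB c)%:E <= lattice_gauss_sum (c *: B) s t + (C * s)%:E))%E.
Proof.
move=> c0; apply: lattice_gauss_sum_cvg; last exact: posdefZ.
by rewrite linearZ /= B_sym.
Qed.

(** Away from x0 the weights are exponentially small, while the number of
    lattice points in W is controlled by comparing the constant function with a
    Gaussian so flat that its exponent stays below half of the gap on W. *)
Lemma tail_mass (r c1 : R) : 0 < r -> 0 < c1 ->
  (\forall k \near \oo, forall x, (W `\` ball x0 r) x -> h x0 + c1 <= h_ k x) ->
  exists2 c : R, 0 < c & exists2 C : R, 0 <= C &
    \forall k \near \oo,
      mass k (W `\` ball x0 r) <= C * expR (- ((n k)%:R * c)).
Proof.
move=> r0 c10 gap.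
have [del del0 Hdel] := qform_lattice_coord B_pos (half_itv R).
have [K [_ /(_ (K + 1))]] := W_bounded; rewrite ltrDl ltr01 => /(_ isT) WK.
pose Q := d%:R ^+ 2 * `|H| * (K + 1 + `|x0|) ^+ 2 + 1.
(* On W the form B in lattice coordinates is at most 2 Q, so eta times it
   is at most the gap c1. *)
pose eta := c1 / (2 * Q).
have Q1 x : W x -> qform H (x - x0) <= Q.
  move=> Wx; apply: le_trans (ler_norm _) _; apply: le_trans (qform_norm_le _
    _) _.
  apply: ler_wpDr => //; apply: ler_wpM2l; first by rewrite mulr_ge0 ?exprn_ge0.
  have xK : `|x - x0| <= K + 1 + `|x0|.
    by rewrite (le_trans (ler_normB _ _))// lerD2r; exact: WK.
  by rewrite lerXn2r ?nnegrE// (le_trans _ xK).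
have Q0 : 0 < Q by rewrite ltr_wpDl// mulr_ge0 ?sqr_ge0// mulr_ge0// exprn_ge0.
have eta0 : 0 < eta by rewrite divr_gt0// mulr_gt0.
have [C C0 HC] := scaled_sum eta0.
exists (c1 / 2); first by rewrite divr_gt0.
exists (LB eta + C); first by rewrite addr_ge0// sqrtr_ge0.
near=> k.
have nk0 : (0 < n k)%N by near: k; exact: near_n_gt0.
have Ak : `|A_ k - A| < del by near: k; exact: near_A.
have [Au Hk] := Hdel _ Ak.
have [s01 s1] : 0 < s_ k <= 1 /\ s_ k < 1 by near: k; exact: near_s.
have gk : forall x, (W `\` ball x0 r) x -> h x0 + c1 <= h_ k x by near: k.
have fS : finite_set ((W `\` ball x0 r) `&` La k).
  by apply: sub_finite_set (finite_lattice (v_ k) nk0 Au W_bounded) => x [[]].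
have SL : (W `\` ball x0 r) `&` La k `<=` La k by move=> x [].
have := @lattice_sum_le R d (n k) (A_ k) (v_ k) x0 nk0 Au (phi k) (eta *: B)
  (c1 / 2) _ fS SL.
set t := (_^-1 *: _); move=> /(_ _)/le_trans le1.
rewrite -lee_fin; apply: le1.
  move=> x [[Wx xr] _].
  have phic : c1 <= phi k x by rewrite /phi lerBrDl; exact: gk.
  have := Hk x0 x; rewrite -/B qform_scalemx => /ler_normlP[+ _].
  set q := qform B _ => hq.
  have q2 : q <= 2 * Q by have := Q1 x Wx; lra.
  have : eta * q <= c1 by rewrite /eta mulrAC ler_pdivrMr ?mulr_gt0//
    ler_wpM2l// ltW.
  lra.
rewrite [(LB eta + C) * _]mulrC EFinM; apply: lee_wpmul2l;
  first by rewrite lee_fin expR_ge0.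
apply: le_trans (HC _ t s01).1 _; rewrite lee_fin lerD2l ler_piMr//.
by case/andP: s01.
Unshelve. all: by end_near.
Qed.

(** Near x0 the exponent is squeezed between two multiples, close to 1, of the
    form B of the lattice coordinates. *)
Lemma local_mass (eps : R) :
  (forall e : R, 0 < e -> exists2 r : R, 0 < r & \forall k \near \oo,
     forall x, ball x0 r x ->
     `|phi k x - qform H (x - x0) / 2| <= e * `|x - x0| ^+ 2) ->
  0 < eps ->
  exists2 r0 : R, 0 < r0 & forall r : R, 0 < r <= r0 ->
    \forall k \near \oo, `|mass k (ball x0 r) - L| <= eps.
Proof.
move=> quad eps0.
have e40 : 0 < eps / 4 by rewrite divr_gt0.
have [th /andP[th0 th1] LBth] := gauss_value_scale detB_gt0 e40.
have [l l0 lH] := posdef_lower Hpos.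
have th2 : 0 < th / 2 < 1 by apply/andP; split; lra.
have [del del0 Hdel] := qform_lattice_coord B_pos th2.
have e10 : 0 < l * th / 8 by rewrite divr_gt0// mulr_gt0.
have [r0 r00 quad1] := quad _ e10.
exists r0 => // r /andP[rgt0 rr0].
have c1 : 0 < 1 - th by lra.
have c2 : 0 < 1 + th by lra.
have c3 : 0 < (1 + th) / 2 by lra.
have [C1 C10 HC1] := scaled_sum c1.
have [C2 C20 HC2] := scaled_sum c2.
have [C3 C30 HC3] := scaled_sum c3.
(* Outside the ball the form B is at least 2 l r^2 / 3; a quarter of it is
   given up for the factor exp(-n ka). *)
pose ka := l * r ^+ 2 / 6.
have ka0 : 0 < ka by rewrite divr_gt0// mulr_gt0// exprn_gt0.
have LB1 : `|LB (1 - th) - L| <= eps / 4.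
  apply: LBth.
  by rewrite addrAC subrr add0r normrN gtr0_norm.
have LB2 : `|LB (1 + th) - L| <= eps / 4.
  by apply: LBth; rewrite addrAC subrr add0r gtr0_norm.
pose es := eps / 4 / (C1 + C2 + 1).
have es0 : 0 < es by rewrite divr_gt0//; apply: ltr_wpDl => //; exact: addr_ge0.
have LB30 : 0 <= LB ((1 + th) / 2) by rewrite sqrtr_ge0.
pose ee := eps / 4 / (LB ((1 + th) / 2) + C3 + 1).
have ee0 : 0 < ee by rewrite divr_gt0//; apply: ltr_wpDl => //; exact: addr_ge0.
near=> k.
have nk0 : (0 < n k)%N by near: k; exact: near_n_gt0.
have Ak : `|A_ k - A| < del by near: k; exact: near_A.
have [Au Hk] := Hdel _ Ak.
have [s01 ses] : 0 < s_ k <= 1 /\ s_ k < es by near: k; exact: near_s.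
have qk : forall x, ball x0 r0 x -> `|phi k x - qform H (x - x0) / 2| <= l * th
  / 8 * `|x - x0| ^+ 2.
  by near: k.
have expk : expR (- ((n k)%:R * ka)) < ee by near: k; exact: near_exp.
have bb : bounded_set (ball x0 r).
  exists (`|x0| + r); split=> [|K Kr x]; first exact: num_real.
  rewrite -ball_normE /= => xr; rewrite -[x](subKr x0).
  by rewrite (le_trans (ler_normB _ _))// (le_trans _ (ltW Kr))// lerD2l ltW.
have fS : finite_set (ball x0 r `&` La k) := finite_lattice (v_ k) nk0 Au bb.
have SL : ball x0 r `&` La k `<=` La k by move=> x [].
have qB0 x : 0 <= qform B (lattice_coord (A_ k) x0 x).
  have := Hk x0 x; rewrite -/B => /(le_trans (normr_ge0 _)).
  by rewrite pmulr_rge0//; case/andP: th2.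
(* Two errors of th / 4 times the form: the remainder of the quadratic
   approximation, and the replacement of A_ k by A. *)
have squeeze x : ball x0 r x ->
    `|phi k x - qform B (lattice_coord (A_ k) x0 x) / 2| <=
    th / 2 * qform B (lattice_coord (A_ k) x0 x).
  move=> xr; have /qk : ball x0 r0 x by apply: le_ball xr.
  have := lH (x - x0); have := Hk x0 x; rewrite -/B; have := qB0 x.
  set q := qform B _; set p := qform H _; set y := `|_| ^+ 2.
  move=> q0 /ler_normlP[h1 h2] h3 h4.
  have h5 : l * th / 8 * y <= th / 8 * p.
    have -> : l * th / 8 * y = th / 8 * (l * y) by ring.
    by rewrite ler_wpM2l// divr_ge0// ltW.
  have h6 : th / 8 * p <= th / 8 * (2 * q).
    rewrite ler_wpM2l ?divr_ge0 ?(ltW th0)//.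
    have : th / 2 * q <= 1 * q by rewrite ler_wpM2r//; case/andP: th2 => _ /ltW.
    lra.
  move: (le_trans h4 (le_trans h5 h6)) => /ler_normlP[h7 h8].
  apply/ler_normlP; split; lra.
rewrite ler_norml lerBrDr lerBlDl; apply/andP; split.
- have := @lattice_sum_ge R d (n k) (A_ k) (v_ k) x0 nk0 Au (phi k)
    ((1 + th) *: B) (((1 + th) / 2) *: B) ka (ball x0 r) fS.
  set t := (_^-1 *: _) => low.
  have := HC2 (s_ k) t s01; have := HC3 (s_ k) t s01.
  move=> [h3 _] [_ h2].
  have {}low : (lattice_gauss_sum ((1 + th) *: B) (s_ k) t <= (mass k (ball x0
    r))%:E +
     (expR (- ((n k)%:R * ka)))%:E * lattice_gauss_sum (((1 + th) / 2) *: B)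
       (s_ k) t)%E.
    apply: low => x.
      move=> /squeeze /ler_normlP[_ h4] _; rewrite qform_scalemx; lra.
    move=> xr; rewrite !qform_scalemx.
    have rx : r <= `|x - x0|.
      by rewrite leNgt distrC; apply/negP => ltr; apply: xr;
        rewrite -ball_normE.
    have r2 : l * r ^+ 2 <= l * `|x - x0| ^+ 2.
      by rewrite ler_pM2l// lerXn2r ?nnegrE// ltW.
    have := lH (x - x0); have := Hk x0 x; rewrite -/B; have := qB0 x.
    set q := qform B _ => q0 /ler_normlP[_ h1] h5.
    have : th / 2 * q <= 1 / 2 * q by rewrite ler_wpM2r// ler_pM2r ?invr_gt0//
      ltW.
    have : 0 <= th * q by rewrite mulr_ge0// ltW.
    rewrite /ka; lra.
  have h4 : (lattice_gauss_sum (((1 + th) / 2) *: B) (s_ k) t <= (LB ((1 + th)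
    / 2) + C3 + 1)%:E)%E.
    apply: le_trans h3 _; rewrite lee_fin.
    have : C3 * s_ k <= C3 by rewrite ler_piMr//; case/andP: s01.
    lra.
  have h5 : ((expR (- ((n k)%:R * ka)))%:E * lattice_gauss_sum (((1 + th) / 2)
    *: B) (s_ k) t <= (eps / 4)%:E)%E.
    apply: le_trans (lee_wpmul2l _ h4) _; first by rewrite lee_fin expR_ge0.
    rewrite -EFinM lee_fin -ler_pdivlMr; first exact: ltW.
    by rewrite ltr_wpDl// addr_ge0.
  have h6 : (LB (1 + th) <= mass k (ball x0 r) + eps / 4 + C2 * s_ k).
    rewrite -lee_fin !EFinD; apply: le_trans h2 _; rewrite leeD2r//.
    by apply: le_trans low _; rewrite leeD2l.
  have h7 : C2 * s_ k <= eps / 4.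
    apply: (@le_trans _ _ ((C1 + C2 + 1) * es)).
      by rewrite ler_pM ?(ltW ses)//; [case/andP: s01 => /ltW| lra].
    by rewrite /es mulrC divfK// gt_eqF// ltr_wpDl// addr_ge0.
  move/ler_normlP: LB2 => [h8 _]; lra.
- have := @lattice_sum_le R d (n k) (A_ k) (v_ k) x0 nk0 Au (phi k) ((1 - th)
    *: B) 0 _ fS SL.
  set t := (_^-1 *: _); rewrite mulr0 oppr0 expR0 mul1e => up.
  have [h1 _] := HC1 (s_ k) t s01.
  have : mass k (ball x0 r) <= LB (1 - th) + C1 * s_ k.
    rewrite -lee_fin; apply: le_trans h1; apply: up => x [/squeeze
      /ler_normlP[h2 _] _].
    rewrite qform_scalemx add0r; lra.
  have h7 : C1 * s_ k <= eps / 4.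
    apply: (@le_trans _ _ ((C1 + C2 + 1) * es)).
      by rewrite ler_pM ?(ltW ses)//; [case/andP: s01 => /ltW| lra].
    by rewrite /es mulrC divfK// gt_eqF// ltr_wpDl// addr_ge0.
  move/ler_normlP: LB1 => [_ h8]; lra.
Unshelve. all: by end_near.
Qed.

End laplace.

(** * Complex-valued sums and the limit *)

Lemma normc_real (R : realType) (a : R) : Normc.normc a%:C = `|a|.
Proof. by rewrite /Normc.normc /= expr0n addr0 sqrtr_sqr. Qed.

Lemma norm_normc (R : realType) (z : R[i]) : `|z| = (Normc.normc z)%:C.
Proof. by rewrite normc_def; case: z. Qed.

Lemma normc_sum_le (R : realType) (T : Type) (r : seq T) (F : T -> R[i]) :
  Normc.normc (\sum_(x <- r) F x) <= \sum_(x <- r) Normc.normc (F x).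
Proof.
elim/big_rec2: _ => [|x a z _ h]; first by rewrite Normc.normc0.
by rewrite (le_trans (le_normcD _ _))// lerD2l.
Qed.

Lemma cvg_complexP (R : realType) (u : nat -> R[i]) (l : R[i]) :
  (forall e : R, 0 < e -> \forall k \near \oo, Normc.normc (u k - l) < e) ->
  (u k : R[i]^o) @[k --> \oo] --> (l : R[i]^o).
Proof.
move=> H; apply/cvgrPdistC_lt => e; rewrite ltcE /= => /andP[/eqP e0 e1].
have := H _ e1; apply: filterS => k; rewrite [`|_|]norm_normc ltcE /= => ->.
by rewrite e0 eqxx.
Qed.

Lemma continuous_complexP (R : realType) (T : topologicalType) (g : T -> R[i])
  x (e : R) :
  {for x, continuous (g : T -> R[i]^o)} -> 0 < e ->
  \forall y \near x, Normc.normc (g y - g x) < e.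
Proof.
move=> /cvgrPdistC_lt gx e0; have := gx e%:C; rewrite ltcR => /(_ e0).
by apply: filterS => y; rewrite [`|_|]norm_normc ltcR.
Qed.

(** On P the values of G are replaced by g0; off P only a crude bound on G is
    used, as the weights there will be exponentially small. *)
Lemma weighted_sum_dist (R : realType) (T : choiceType) (S P : set T)
    (G : T -> R[i]) (w : T -> R) (g0 : R[i]) (L a b : R) :
  finite_set S -> (forall x, 0 <= w x) ->
  (forall x, (S `&` P) x -> Normc.normc (G x - g0) <= a) ->
  (forall x, (S `&` ~` P) x -> Normc.normc (G x) <= b) ->
  Normc.normc (\sum_(x \in S) G x * (w x)%:C - g0 * L%:C) <=
    a * \sum_(x \in S `&` P) w x + b * \sum_(x \in S `&` ~` P) w x +
    Normc.normc g0 * `|\sum_(x \in S `&` P) w x - L|.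
Proof.
move=> fS w0 nearG farG.
have fP : finite_set (S `&` P) by apply: sub_finite_set fS => x [].
have fQ : finite_set (S `&` ~` P) by apply: sub_finite_set fS => x [].
rewrite (fsbigID P)//=.
have -> : \sum_(x \in S `&` P) G x * (w x)%:C =
    \sum_(x \in S `&` P) (G x - g0) * (w x)%:C + g0 * (\sum_(x \in S `&` P) w
      x)%:C.
  rewrite !fsbig_finite// raddf_sum mulr_sumr -big_split /=.
  by apply: eq_bigr => x _; rewrite -mulrDl subrK.
have -> (p q r s : R[i]) : p + q + r - s = p + r + (q - s) by ring.
rewrite -mulrBr -raddfB (le_trans (le_normcD _ _))//= Normc.normcM normc_real
  lerD2r.
rewrite (le_trans (le_normcD _ _))// !fsbig_finite// lerD//.
  rewrite (le_trans (normc_sum_le _ _))// mulr_sumr big_seq [leRHS]big_seq.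
  apply: ler_sum => x; rewrite in_fset_set// inE => Sx.
  by rewrite Normc.normcM normc_real ger0_norm// ler_wpM2r// nearG.
rewrite (le_trans (normc_sum_le _ _))// mulr_sumr big_seq [leRHS]big_seq.
apply: ler_sum => x; rewrite in_fset_set// inE => Sx.
by rewrite Normc.normcM normc_real ger0_norm// ler_wpM2r// farG.
Qed.

Lemma normc_ge0 (R : realType) (z : R[i]) : 0 <= Normc.normc z.
Proof. by case: z => x y; rewrite /Normc.normc sqrtr_ge0. Qed.

Lemma csupnorm_ub (R : realType) T (S : set T) (f : T -> R[i]) e x :
  (csupnorm S f <= e%:E)%E -> S x -> Normc.normc (f x) <= e.
Proof. by move=> h Sx; apply: le_trans (ler_norm _) (supnorm_ub h Sx). Qed.

Lemma limn_einf_gap (R : realType) (T : Type) (S : set T)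
    (f : nat -> T -> R) (m : R) :
  (m%:E < limn_einf (fun k => ereal_inf [set (f k x)%:E | x in S]))%E ->
  exists2 c : R, 0 < c & \forall k \near \oo, forall x, S x -> m + c <= f k x.
Proof.
rewrite limn_einf_lim; set u := (fun k => _) => mu.
have [c c0 mc] : exists2 c : R, 0 < c & ((m + c)%:E < limn (einfs u))%E.
  move: mu; case: (limn (einfs u)) => [l| |] //.
  - rewrite lte_fin => ml; exists ((l - m) / 2);
      first by rewrite divr_gt0// subr_gt0.
    by rewrite lte_fin; lra.
  - by exists 1 => //; rewrite ltry.
exists c => //; have := lte_lim (@nondecreasing_einfs _ u) (@is_cvg_einfs _ u)
  mc.
apply: filterS => k mck x Sx; rewrite -lee_fin; apply: le_trans mck _.
apply: (@le_trans _ _ (u k)).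
  by apply: ereal_inf_lbound; exists k => /=.
by apply: ereal_inf_lbound; exists x.
Qed.

Theorem theorem2p7 (R : realType) (d : nat) (d_gt0 : (0 < d)%N)
    (W : set 'rV[R]_d) (W_bounded : bounded_set W)
    (n : nat -> nat) (n_gt0 : forall k, (0 < k)%N -> (0 < n k)%N)
    (n_ge : forall k, (0 < k)%N -> (k <= n k)%N)
    (v_ : nat -> 'rV[R]_d) (v : 'rV[R]_d) (v_cvg : v_ k @[k --> \oo] --> v)
    (A_ : nat -> 'M[R]_d) (A : 'M[R]_d) (A_cvg : A_ k @[k --> \oo] --> A)
    (A_inv : A \in unitmx)
    (g_ : nat -> 'rV[R]_d -> R[i]) (h_ : nat -> 'rV[R]_d -> R)
    (x0 : 'rV[R]_d) (N0 : set 'rV[R]_d)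
    (g : 'rV[R]_d -> R[i]) (h : 'rV[R]_d -> R)
    (H : discrete_laplace W (fun k => lattice (n k) (A_ k) (v_ k))
           g_ h_ x0 N0 g h) :
  ((((n k)%:R `^ (- (d%:R / 2)) * expR ((n k)%:R * h x0))%:C *
    \sum_(x \in W `&` lattice (n k) (A_ k) (v_ k))
      g_ k x * (expR (- ((n k)%:R * h_ k x)))%:C) : R[i]^o) @[k --> \oo] -->
  ((((2 * pi) `^ (d%:R / 2))%:C * g x0 /
    (`|\det A| * Num.sqrt (\det (hessian h x0)))%:C) : R[i]^o).
Proof.
case: H => _ oN0 N0x0 N0W hkC2 gcont hC2 gcvg hcvg hkx0 gradx0 Hpos sep [Cg [l
  [Cg0 gbound]]].
have Hsym := hessian_sym oN0 N0x0 hC2.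
set La := fun k => lattice (n k) (A_ k) (v_ k).
pose w k := weight (n k) (fun x => h_ k x - h x0).
pose mass k S := \sum_(x \in S `&` La k) w k x.
pose L := Num.sqrt ((2 * pi) ^+ d / \det (A^T *m hessian h x0 *m A)).
have w0 k x : 0 <= w k x by exact: weight_ge0.
have detA0 : \det A != 0 by move: A_inv; rewrite unitmxE unitfE.
have Bpos : posdefmx (A^T *m hessian h x0 *m A) by exact: posdef_congr.
have detH0 : 0 < \det (hessian h x0) by exact: posdef_det_gt0.
have -> : ((2 * pi) `^ (d%:R / 2))%:C * g x0 /
    (`|\det A| * Num.sqrt (\det (hessian h x0)))%:C = g x0 * L%:C.
  rewrite mulrAC -fmorphV -rmorphM /= mulrC; congr (_ * _%:C).
  rewrite powRrM powR12_sqrt ?powR_ge0// powR_mulrn;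
    last by rewrite mulr_ge0// pi_ge0.
  rewrite /L !det_mulmx det_tr mulrAC -expr2 sqrtrM ?exprn_ge0 ?mulr_ge0
    ?pi_ge0//.
  congr (_ * _); rewrite sqrtrV ?(mulr_ge0 (sqr_ge0 _) (ltW detH0))//.
  by rewrite sqrtrM ?sqr_ge0// sqrtr_sqr.
apply: cvg_complexP => e e0.
pose G := Normc.normc (g x0).
have G0 : 0 <= G by exact: normc_ge0.
have L0 : 0 <= L by rewrite sqrtr_ge0.
(* The three contributions (weights near x0, weights far from it, error of the
   total mass near x0) get e / 4 each. *)
pose del := Num.min 1 (e / 4 / (G + 1)).
have del0 : 0 < del by rewrite lt_min ltr01 !divr_gt0// ltr_wpDl.
pose a := e / 4 / (L + 1).
have a0 : 0 < a by rewrite !divr_gt0// ltr_wpDl.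
have a20 : 0 < a / 2 by rewrite divr_gt0.
have quad e1 : 0 < e1 -> exists2 r : R, 0 < r & \forall k \near \oo, forall x,
  ball x0 r x ->
    `|h_ k x - h x0 - qform (hessian h x0) (x - x0) / 2| <= e1 * `|x - x0| ^+ 2.
  by move=> /(local_quadratic oN0 N0x0 hkC2 hC2 hcvg hkx0 gradx0)[r r0 [_ ?]];
    exists r.
have [r0 r00 locm] := local_mass v_ n_ge A_cvg A_inv Hsym Hpos quad del0.
have gx0 : {for x0, continuous (g : 'rV[R]_d -> R[i]^o)}.
  exact: within_open_continuous gcont.
have [r1 /= r10 r1P] := (nbhs_ballP _ _).1
  (filterI (open_nbhs_nbhs (conj oN0 N0x0)) (continuous_complexP gx0 a20)).
pose r := Num.min r0 r1.
have rr : 0 < r <= r0 by rewrite lt_min r00 r10 ge_min lexx.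
have r_gt0 : 0 < r by case/andP: rr.
have ballr x : ball x0 r x -> N0 x /\ Normc.normc (g x - g x0) < a / 2.
  by move=> xr; apply: r1P; apply: le_ball xr; rewrite ge_min lexx orbT.
have [c1 c10 gap] := limn_einf_gap (sep _ (ball_open x0 r) (ballxx x0 r_gt0)).
have [c c0 [C C0 tailm]] :=
  tail_mass v_ W_bounded n_ge A_cvg A_inv Hsym Hpos r_gt0 c10 gap.
have e4 : 0 < e / 4 / (Cg * C + 1) by rewrite !divr_gt0// ltr_wpDl// mulr_ge0.
have [M HM] := poly_exp_small l c0 e4.
have [del' del'0 Hdel'] := qform_lattice_coord (e := 2^-1) Bpos (half_itv R).
near=> k.
have k0 : (0 < k)%N by near: k; exists 1%N.
have Ak : `|A_ k - A| < del' by near: k; have /cvgrPdistC_lt := A_cvg; apply.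
have [Au _] := Hdel' _ Ak.
have fS := finite_lattice (v_ k) (n_gt0 k k0) Au W_bounded.
have massk : `|mass k (ball x0 r) - L| <= del by near: k; exact: locm.
have tailk : mass k (W `\` ball x0 r) <= C * expR (- ((n k)%:R * c)) by near: k.
have nM : M < (n k)%:R by near: k; exact: near_n_gt.
have gk : (csupnorm (N0 `&` La k) (g_ k \- g)%R <= (a / 2)%:E)%E.
  apply: ltW; near: k; apply: (gcvg [set y | (y < (a / 2)%:E)%E]).
  by apply: open_nbhs_nbhs; split; [exact: open_ereal_lt_ereal|rewrite /=
    lte_fin].
have nearE : W `&` La k `&` ball x0 r = ball x0 r `&` La k.
  apply/seteqP; split => [x [[_ Lx] xr] //|x [xr Lx]]; split => //.
  by split => //; apply: N0W; exact: (ballr x xr).1.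
have farE : W `&` La k `&` ~` ball x0 r = (W `\` ball x0 r) `&` La k.
  by apply/seteqP; split => x [[? ?] ?].
have nearG x : (W `&` La k `&` ball x0 r) x -> Normc.normc (g_ k x - g x0) <= a.
  rewrite nearE => -[xr Lx]; have [N0x gx] := ballr x xr.
  have := csupnorm_ub gk (conj N0x Lx); rewrite /= => gkx.
  by rewrite -(subrKA (g x)) (splitr a) (le_trans (le_normcD _ _))// lerD// ltW.
have farG x : (W `&` La k `&` ~` ball x0 r) x ->
    Normc.normc (g_ k x) <= Cg * (n k)%:R ^+ l.
  move=> [Sx _]; apply: le_trans (csupnorm_ub (gbound k k0) Sx) _.
  by rewrite ler_wpM2l// lerXn2r ?nnegrE// ler_nat n_ge.
have := @weighted_sum_dist R _ _ (ball x0 r) (g_ k) (w k) (g x0) L a _ fS (w0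
  k) nearG farG.
rewrite nearE farE -/(mass k _) -/(mass k _) -/G => dist.
have -> : (((n k)%:R `^ (- (d%:R / 2)) * expR ((n k)%:R * h x0))%:C *
    \sum_(x \in W `&` La k) g_ k x * (expR (- ((n k)%:R * h_ k x)))%:C) =
    \sum_(x \in W `&` La k) g_ k x * (w k x)%:C.
  rewrite !fsbig_finite// mulr_sumr; apply: eq_bigr => x _.
  rewrite mulrCA -rmorphM /=; congr (_ * _%:C).
  rewrite /w /weight -mulrA -expRD; congr (_ * expR _); last by ring.
  by rewrite powRN mulrC powRrM powR12_sqrt// powR_mulrn ?sqrtr_ge0// exprVn.
apply: le_lt_trans dist _.
have near_le : a * mass k (ball x0 r) <= e / 4.
  have -> : e / 4 = a * (L + 1) by rewrite /a divfK// gt_eqF// ltr_wpDl.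
  rewrite ler_pM2l//; move/ler_normlP: massk => [_].
  by rewrite lerBlDl => /le_trans -> //; rewrite lerD2l ge_min lexx.
have far_lt : Cg * (n k)%:R ^+ l * mass k (W `\` ball x0 r) <= e / 4.
  have nl0 : 0 <= (n k)%:R ^+ l :> R by rewrite exprn_ge0.
  apply: le_trans (ler_wpM2l (mulr_ge0 Cg0 nl0) tailk) _.
  rewrite mulrACA; apply: (@le_trans _ _ ((Cg * C + 1) *
    ((n k)%:R ^+ l * expR (- ((n k)%:R * c))))).
    by rewrite ler_wpM2r ?mulr_ge0 ?expR_ge0// lerDl.
  rewrite mulrC -ler_pdivlMr; first by apply/ltW/HM.
  by apply: ltr_wpDl => //; exact: mulr_ge0.
have g0_le : G * `|mass k (ball x0 r) - L| <= e / 4.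
  apply: (@le_trans _ _ ((G + 1) * (e / 4 / (G + 1)))).
    by rewrite ler_pM// ?lerDl// (le_trans massk)// ge_min lexx orbT.
  by rewrite mulrC divfK// gt_eqF// ltr_wpDl.
apply: (@le_lt_trans _ _ (e / 4 + e / 4 + e / 4)); first by rewrite !lerD.
lra.
Unshelve. all: by end_near.
Qed.
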